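(* Let $a,b\geqslant 2$ be coprime positive integers, let $\alpha$ be a real irrational number and let $\beta$ be a real number. Then for any $\varepsilon>0$ there exist infinitely many integers $q\in\Sigma$ such that $$\|q\alpha-\beta\|\leqslant \frac{1}{(\log\log\log q)^{\frac18-\varepsilon}}.$$
   Context: $\Sigma=\{a^ub^v:\ u,v \text{ nonnegative integers}\}$. $\|x\|=\min_{k\in\mathbb{Z}}|x-k|$ denotes the distance from $x$ to the nearest integer. *)

(* Defs.v *)
From mathcomp Require Import all_boot all_order all_algebra.
From mathcomp Require Import lra.
From mathcomp Require Import boolp classical_sets functions cardinality.
From mathcomp Require Import reals exp.

Set Implicit Arguments.
Unset Strict Implicit.
Unset Printing Implicit Defensive.

Import Order.TTheory GRing.Theory Num.Theory.
Local Open Scope classical_set_scope.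
Local Open Scope ring_scope.

Definition Sigma (a b : nat) : set nat :=
  [set q | exists u v : nat, q = (a ^ u * b ^ v)%N].

Definition dist_int (R : realType) (x : R) : R :=
  inf [set `|x - k%:~R| | k in [set: int]].

Lemma dist_int_min (R : realType) (x : R) :
  (exists k : int, dist_int x = `|x - k%:~R|) /\
  (forall k : int, dist_int x <= `|x - k%:~R|).
Proof.
have lb0 : has_lbound [set `|x - k%:~R| | k in [set: int]].
  by exists 0 => _ [k _ <-]; exact: normr_ge0.
have le_dist k : dist_int x <= `|x - k%:~R| by apply: ge_inf => //; exists k.
split=> //.
have [i iP] : exists i : int, forall k : int, `|x - i%:~R| <= `|x - k%:~R|.
  have := Num.Theory.floor_le x; have := Num.Theory.floorD1_gt x.
  set f := Num.floor x => xf fx.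
  have fk (k : int) : (k%:~R <= f%:~R :> R) || (f%:~R + 1 <= k%:~R :> R).
    by rewrite -[1](mulr1z 1) -intrD !ler_int lezD1; case: leP.
  rewrite intrD in xf.
  have [h|h] := leP (x - f%:~R) (f%:~R + 1 - x).
    exists f => k; rewrite ger0_norm ?subr_ge0//.
    by case/orP: (fk k) => ?; rewrite ler_normr; apply/orP; [left|right]; lra.
  exists (f + 1) => k; rewrite intrD ler0_norm; last by lra.
  by case/orP: (fk k) => ?; rewrite ler_normr; apply/orP; [left|right]; lra.
exists i; apply/eqP; rewrite eq_le le_dist /=.
by apply: lb_le_inf; [exists `|x - i%:~R|, i|move=> _ [k _ <-]].
Qed.

(* Main.v *)
(* Fix a scale k, put L = a ^ (7 * k), and let N = a ^ n with n of order k * L.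

   Pigeonhole and a Dirichlet denominator D of alpha give two powers of a, of size
   polynomial in D, such that the difference d of their multiples of alpha is small
   mod 1, but at least 1 / (2 * D). Choosing A, B in Sigma with A / B slightly above
   1, the numbers d * a ^ s * A ^ j * B ^ (J - j) go round the circle in steps at most
   1 / N. They are differences of points of the orbit Sigma * alpha, which therefore
   meets at least (N / 2) ^ (1 / 2) of the N cells of length 1 / N. Counting base-a
   expansions block by block, some block of 7 * k digits takes at least a ^ (3 * k)
   values once all later digits are prescribed. Multiplication by a brings this block
   to the front; multiplying next by the powers of b, which equidistribute modulo L
   since a and b are coprime, a second-moment argument yields one power of b making
   the a ^ (3 * k) residues 2 * a ^ -k-dense.

   With k as large as D permits, the integers used are at most
   exp (exp (exp (C * k * a ^ (7 * k)))), and (a ^ k / 2) ^ 8 exceeds C * k * a ^ (7 * k) for large k. *)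
Require Import Defs.
From mathcomp Require Import all_boot all_order all_algebra.
From mathcomp Require Import zify ring lra cyclic.
From mathcomp Require Import boolp classical_sets functions cardinality.
From mathcomp Require Import reals sequences exp.
Import Order.TTheory GRing.Theory Num.Theory.

Set Implicit Arguments.
Unset Strict Implicit.
Unset Printing Implicit Defensive.

(** * Powers of [b] modulo powers of [a] *)

(** Binomial expansion modulo a divisor of [y ^ 2]: only the linear term survives. *)
Lemma expn1D_mod (y m i : nat) : m %| y ^ 2 -> (1 + y) ^ i = 1 + i * y %[mod m].
Proof.
move=> my; elim: i => [|i IHi] //.
rewrite expnS -modnMmr IHi modnMmr.
have -> : (1 + y) * (1 + i * y) = i * y ^ 2 + (1 + i.+1 * y) by lia.
by rewrite -modnDml (eqP (dvdn_mull i my)) add0n.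
Qed.

Lemma sum_expn1D_mod (y m t : nat) : m %| y ^ 2 ->
  \sum_(i < t) (1 + y) ^ i = t + 'C(t, 2) * y %[mod m].
Proof.
move=> my; elim: t => [|t IHt]; first by rewrite big_ord0.
rewrite big_ord_recr /= -modnDm IHt (expn1D_mod _ my) modnDm.
congr (_ %% _); rewrite binS bin1; lia.
Qed.

(** One step of lifting the exponent: [x ^ p - 1] is [x - 1] times a geometric sum, and that sum is
    [p] modulo [p ^ 2], so it has exactly one factor [p]. *)
Lemma logn_predn_exp_prime (p x : nat) : prime p -> p %| x.-1 ->
    (p = 2 -> 4 %| x.-1) -> 1 < x ->
  logn p (x ^ p).-1 = (logn p x.-1).+1.
Proof.
move=> pp; case: x => [|y] // py p4 y0.
rewrite /= in py p4; rewrite predn_exp /=.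
have p0 := prime_gt0 pp.
have sE m : m %| y ^ 2 -> \sum_(i < p) y.+1 ^ i = p + 'C(p, 2) * y %[mod m].
  by move=> h; rewrite -(sum_expn1D_mod p h) add1n.
(* For odd [p] one factor comes from the binomial coefficient; for [p = 2] that coefficient is 1 and
   [4 %| x.-1] steps in. *)
have pCy : p ^ 2 %| 'C(p, 2) * y.
  have [p2|p2] := eqVneq p 2; first by rewrite p2 /= mul1n p4.
  rewrite expnS expn1 dvdn_mul //; apply: prime_dvd_bin => //=.
  by have := prime_gt1 pp; lia.
have s0 : 0 < \sum_(i < p) y.+1 ^ i.
  by rewrite -(prednK p0) big_ord_recl.
rewrite lognM // -[RHS]addn1; congr (_ + _); apply/eqP.
rewrite eqn_leq -pfactor_dvdn // expn1 andbC; apply/andP; split.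
  rewrite /dvdn sE; last by rewrite dvdn_exp.
  by rewrite -/(dvdn _ _) dvdn_addr ?dvdn_mull.
rewrite leqNgt -pfactor_dvdn // /dvdn sE; last by rewrite dvdn_exp2r.
rewrite -/(dvdn _ _) dvdn_addl //.
apply/negP => /(dvdn_leq p0); rewrite expnS expn1.
by have := prime_gt1 pp; nia.
Qed.

(** Factors [p] of [t] are stripped with the prime case; once [p] does not divide [t], the geometric
    sum is [t] modulo [p], hence prime to [p]. *)
Lemma logn_predn_exp (p x t : nat) : prime p -> p %| x.-1 ->
    (p = 2 -> 4 %| x.-1) -> 1 < x -> 0 < t ->
  logn p (x ^ t).-1 = logn p x.-1 + logn p t.
Proof.
move=> pp; elim/ltn_ind: t x => t IHt x px p4 x1 t0.
have p0 := prime_gt0 pp.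
have dx n : x.-1 %| (x ^ n).-1 by rewrite predn_exp dvdn_mulr.
have [/dvdnP[t' tE]|npt] := boolP (p %| t).
  have t'0 : 0 < t' by move: t0; rewrite tE; case: (t').
  have t't : t' < t by rewrite tE; have := prime_gt1 pp; nia.
  rewrite tE mulnC expnM IHt //.
  - by rewrite logn_predn_exp_prime // lognM // (logn_prime p pp) eqxx addSnnS.
  - exact: dvdn_trans px (dx _).
  - by move/p4 => h; exact: dvdn_trans h (dx _).
  - by rewrite -(exp1n p) ltn_exp2r.
have s0 : 0 < \sum_(i < t) x ^ i by rewrite -(prednK t0) big_ord_recl.
rewrite predn_exp lognM //; last by lia.
congr (_ + _).
have npS : ~~ (p %| \sum_(i < t) x ^ i).
  have -> : x = 1 + x.-1 by lia.
  rewrite /dvdn sum_expn1D_mod; last by rewrite dvdn_exp.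
  by rewrite -/(dvdn _ _) dvdn_addl ?dvdn_mull.
by rewrite (lognE p t) (negbTE npt) !andbF lognE (negbTE npS) !andbF.
Qed.

(** Both multiples have equal valuation at each prime dividing [a], by lifting the exponent;
    [a ^ 2 %| x.-1] supplies the factor 4 needed at 2. The exponential in [t] thus becomes linear
    for divisibility by powers of [a]. *)
Lemma dvdn_mul_predn_exp (a x l d t : nat) : 0 < a -> 1 < x -> a ^ 2 %| x.-1 ->
  (a ^ l %| d * (x ^ t).-1) = (a ^ l %| d * (x.-1 * t)).
Proof.
move=> a0 x1 ax.
case: (posnP d) => [->|d0]; first by rewrite !mul0n.
case: (posnP t) => [->|t0]; first by rewrite expn0 !muln0.
have xt0 : 0 < (x ^ t).-1 by rewrite -subn1 subn_gt0 -(exp1n t) ltn_exp2r.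
have al0 : 0 < a ^ l by rewrite expn_gt0 a0.
have lE p : prime p -> p %| a ->
    logn p (d * (x ^ t).-1) = logn p (d * (x.-1 * t)).
  move=> pp pa; rewrite !lognM ?muln_gt0 //; try lia.
  rewrite (@logn_predn_exp p x) //.
    by apply: dvdn_trans ax; rewrite expnS dvdn_mulr.
  by move=> p2; apply: dvdn_trans ax; rewrite -[4]/(2 ^ 2) dvdn_exp2r // -p2.
suff h m n : 0 < m -> 0 < n -> (forall p, prime p -> p %| a -> logn p m = logn p n) ->
    a ^ l %| m -> a ^ l %| n.
  apply/idP/idP; apply: h; rewrite ?muln_gt0 ?d0 ?t0 ?xt0 ?andbT //=; try lia.
  by move=> p pp pa; rewrite lE.
move=> m0 n0 mn /dvdn_partP h; apply/dvdn_partP => // p.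
rewrite mem_primes => /and3P[pp _ pal].
have pa : p %| a by move: pal; rewrite Euclid_dvdX // => /andP[].
rewrite p_part pfactor_dvdn // -mn // -pfactor_dvdn // -p_part.
by apply: h; rewrite // mem_primes pp al0.
Qed.

(** * Dense dilations of large sets of residues *)

Lemma card_eqmod (n m : nat) (A : {set 'I_n}) :
  {in A &, forall x y : 'I_n, x = y %[mod m]} -> #|A| <= (n.-1 %/ m).+1.
Proof.
move=> Am; pose f (x : 'I_n) : 'I_(n.-1 %/ m).+1 := inord (x %/ m).
rewrite -(@card_in_imset _ _ f) => [|x y xA yA].
  by apply: leq_trans (max_card _) _; rewrite card_ord.
have fE (z : 'I_n) : f z = z %/ m :> nat.
  by rewrite inordK // ltnS leq_div2r //; case: z => z /= zn; lia.
move/(congr1 (@nat_of_ord _)); rewrite !fE => xy.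
by apply: val_inj; rewrite /= (divn_eq x m) (divn_eq y m) xy (Am x y xA yA).
Qed.

Lemma card_eqmod_dvd (n m s : nat) (A : {set 'I_n}) : 0 < n -> n = m * s ->
  {in A &, forall x y : 'I_n, x = y %[mod m]} -> #|A| <= s.
Proof.
move=> n0 nE /card_eqmod /leq_trans; apply.
have m0 : 0 < m by move: n0; rewrite nE muln_gt0 => /andP[].
by rewrite ltn_divLR // mulnC -nE; lia.
Qed.

(** Truncated subtraction makes [(i - j) + (j - i)] the distance between [i] and [j]; this form of
    it is used below. *)
Lemma dvdn_dist (g i j : nat) : (g %| (i - j) + (j - i)) = (i == j %[mod g]).
Proof.
have [ij|ji] := leqP i j.
  by rewrite (eqP ij) add0n -eqn_mod_dvd // eq_sym.
by rewrite (eqP (ltnW ji)) addn0 -eqn_mod_dvd // ltnW.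
Qed.

(** * Number of divisors and sums of gcds *)

Definition ndiv (n : nat) := size (divisors n).

Lemma ndiv_mul (m n : nat) : 0 < m -> 0 < n -> ndiv (m * n) <= ndiv m * ndiv n.
Proof.
move=> m0 n0; rewrite /ndiv -(size_allpairs muln); apply: uniq_leq_size.
  exact: divisors_uniq.
move=> d; rewrite -dvdn_divisors ?muln_gt0 ?m0 // => dmn.
have g0 : 0 < gcdn d m by rewrite gcdn_gt0 m0 orbT.
apply/allpairsP; exists (gcdn d m, d %/ gcdn d m) => /=.
rewrite -!dvdn_divisors // dvdn_gcdr; split=> //; last first.
  by rewrite mulnC divnK // dvdn_gcdl.
have cop : coprime (d %/ gcdn d m) (m %/ gcdn d m).
  rewrite /coprime -(eqn_pmul2r g0) mul1n muln_gcdl !divnK //.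
    exact: dvdn_gcdr.
  exact: dvdn_gcdl.
rewrite -(Gauss_dvdr _ cop) -(dvdn_pmul2r g0) divnK ?dvdn_gcdl //.
by rewrite mulnAC divnK // dvdn_gcdr.
Qed.

Lemma ndiv_expn_prime (p k : nat) : prime p -> ndiv (p ^ k) <= k.+1.
Proof.
move=> pp; rewrite /ndiv -[X in _ <= X](size_iota 0) -[X in _ <= X](size_map (expn p)).
apply: uniq_leq_size; first exact: divisors_uniq.
move=> d; rewrite -dvdn_divisors ?expn_gt0 ?prime_gt0 // => /(dvdn_pfactor _ _ pp)[m mk ->].
by apply: map_f; rewrite mem_iota.
Qed.

(** Split off the least prime factor: each contributes a factor [l + 1], and there are at most [a]
    of them. The bound is crude, but polynomial in [l]. *)
Lemma ndiv_expn (a l : nat) : 0 < a -> ndiv (a ^ l) <= l.+1 ^ a.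
Proof.
elim/ltn_ind: a => a IH a0.
have [a1|a1] := leqP a 1.
  have a1E : a = 1 by lia.
  by rewrite a1E exp1n expn1.
have pp := pdiv_prime a1; set p := pdiv a in pp.
have aE : a = p * (a %/ p) by rewrite mulnC divnK // pdiv_dvd.
have q0 : 0 < a %/ p by rewrite divn_gt0 ?prime_gt0 // dvdn_leq // pdiv_dvd.
have qa : a %/ p < a by rewrite ltn_Pdiv // prime_gt1.
rewrite {1}aE expnMn; apply: leq_trans (ndiv_mul _ _) _.
- by rewrite expn_gt0 prime_gt0.
- by rewrite expn_gt0 q0.
apply: leq_trans (leq_mul (ndiv_expn_prime l pp) (IH _ qa q0)) _.
by rewrite -expnS leq_pexp2l.
Qed.

(* Pillai's sum: sort the j by the common divisor g = gcd (M, i - j). *)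
Lemma sum_gcd_dist (M i : nat) : 0 < M ->
  \sum_(j < M) gcdn M ((i - j) + (j - i)) <= ndiv M * M.
Proof.
move=> M0.
have gE x : gcdn M x <= \sum_(g <- divisors M) g * (g %| x).
  have gM : gcdn M x \in divisors M by rewrite -dvdn_divisors // dvdn_gcdl.
  by rewrite (big_rem _ gM) /= dvdn_gcdr muln1 leq_addr.
apply: leq_trans (leq_sum _ (fun (j : 'I_M) _ => gE _)) _.
rewrite exchange_big /= /ndiv -sum1_size big_distrl /=.
rewrite big_seq [X in _ <= X]big_seq; apply: leq_sum => g.
rewrite -dvdn_divisors // => gM.
rewrite -big_distrr /= mul1n -[X in _ <= X](divnK gM) mulnC leq_mul2r.
apply/orP; right.
rewrite -big_mkcond sum1_card -cardsE.
apply: (@card_eqmod_dvd M g) => //; first by rewrite mulnC divnK.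
move=> x y; rewrite !inE => xg yg.
have /eqP <- : i == x %[mod g] by rewrite -dvdn_dist; exact: xg.
by have /eqP <- : i == y %[mod g] by rewrite -dvdn_dist; exact: yg.
Qed.

Lemma sqr_sum_leq (I : finType) (A : {set I}) (f : I -> nat) :
  (\sum_(i in A) f i) ^ 2 <= #|A| * \sum_(i in A) f i ^ 2.
Proof.
rewrite -(leq_pmul2l (isT : 0 < 2)) mulnA -mulnn big_distrl /= big_distrr /=.
apply: (@leq_trans (\sum_(i in A) \sum_(j in A) (f i ^ 2 + f j ^ 2))).
  apply: leq_sum => i _; rewrite mulnA !big_distrr /=; apply: leq_sum => j _.
  by rewrite -mulnA; exact: (nat_Cauchy (f i) (f j)).1.
under eq_bigr do rewrite big_split /= sum_nat_const.
by rewrite big_split /= -big_distrr /= sum_nat_const; lia.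
Qed.

(** Subtracting two collisions, [M] divides [(x ^ (t1 - t2) - 1) * (j - j')]; the hypothesis
    linearises this, so [t1 - t2] is a multiple of [M / s], which leaves at most [s] exponents below
    [M]. *)
Lemma card_exp_hits (x M j j' i i' s : nat) :
    0 < M -> 0 < x -> coprime M x ->
    (forall d t, (M %| d * (x ^ t).-1) = (M %| d * (x.-1 * t))) ->
    s = gcdn M (x.-1 * ((j - j') + (j' - j))) ->
  #|[set t : 'I_M | x ^ t * j + i == x ^ t * j' + i' %[mod M]]| <= s.
Proof.
move=> M0 x0 cMx xM sE.
wlog jj : j j' i i' sE / j' <= j.
  move=> W; have [jj|/ltnW jj] := leqP j' j; first exact: W.
  have sE' : s = gcdn M (x.-1 * ((j' - j) + (j - j'))) by rewrite [_ - _ + _]addnC.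
  apply: leq_trans (W j' j i' i sE' jj).
  by apply: eq_leq; apply: eq_card => t; rewrite !inE eq_sym.
move: sE; have -> : (j - j') + (j' - j) = j - j' by lia.
move=> sE; have s0 : 0 < s by rewrite sE gcdn_gt0 M0.
have sM : s %| M by rewrite sE dvdn_gcdl.
have key (t1 t2 : 'I_M) : t2 <= t1 ->
    x ^ t1 * j + i = x ^ t1 * j' + i' %[mod M] ->
    x ^ t2 * j + i = x ^ t2 * j' + i' %[mod M] -> M %/ s %| t1 - t2.
  move=> t21 e1 e2.
  have E t : x ^ t * j + i = x ^ t * j' + i' %[mod M] ->
      x ^ t * (j - j') + i = i' %[mod M].
    move/eqP; rewrite -{1}(subnKC jj) mulnDr -addnA eqn_modDl => /eqP; exact.
  have e3 : M %| x ^ t1 * (j - j') - x ^ t2 * (j - j').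
    rewrite -eqn_mod_dvd; last by rewrite leq_mul2r leq_pexp2l ?orbT.
    by rewrite -(eqn_modDr i) (E _ e1) (E _ e2).
  move: e3; rewrite -{1}(subnK t21) expnD -mulnBl -{2}(mul1n (x ^ t2)) -mulnBl.
  rewrite -mulnA mulnCA Gauss_dvdr ?coprimeXr // subn1 mulnC xM mulnA [_ * x.-1]mulnC.
  move: sE sM s0; set D := _ * _ => sE sM s0 /dvdnP[q qE].
  apply/dvdnP.
  have sD : s %| D by rewrite sE dvdn_gcdr.
  have cop : coprime (M %/ s) (D %/ s).
    rewrite /coprime -(eqn_pmul2r s0) mul1n muln_gcdl (divnK sM) (divnK sD).
    by rewrite -sE.
  have : M %/ s %| D %/ s * (t1 - t2).
    rewrite -(dvdn_pmul2r s0) (divnK sM) mulnAC (divnK sD) qE.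
    by rewrite dvdn_mull.
  by rewrite Gauss_dvdr // => /dvdnP.
apply: (@card_eqmod_dvd M (M %/ s)) => //; first by rewrite divnK.
move=> t1 t2; rewrite !inE => /eqP e1 /eqP e2; apply/eqP.
have [h|/ltnW h] := leqP t2 t1; first by rewrite eqn_mod_dvd // key.
by rewrite eq_sym eqn_mod_dvd // key.
Qed.

(** A collision fixes [i'] modulo [s], because [s] divides [(x ^ t - 1) * (j - j')]. So at most
    [(h - 1) / s + 1] values of [i'] occur, each for at most [s] exponents. *)
Lemma sum_exp_hits (x M j j' i h s : nat) :
    0 < M -> 0 < x -> coprime M x ->
    (forall d t, (M %| d * (x ^ t).-1) = (M %| d * (x.-1 * t))) ->
    s = gcdn M (x.-1 * ((j - j') + (j' - j))) ->
  \sum_(t < M) \sum_(i' < h) (x ^ t * j + i == x ^ t * j' + i' %[mod M]) <= h + s.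
Proof.
move=> M0 x0 cMx xM sE; rewrite exchange_big /=.
have s0 : 0 < s by rewrite sE gcdn_gt0 M0.
pose I' := [set i' : 'I_h | [exists t : 'I_M, x ^ t * j + i == x ^ t * j' + i' %[mod M]]].
have I's : #|I'| <= (h.-1 %/ s).+1.
  apply: card_eqmod => u v; rewrite !inE.
  have E (w : 'I_h) : [exists t : 'I_M, x ^ t * j + i == x ^ t * j' + w %[mod M]] ->
      j' + w = j + i %[mod s].
    case/existsP => t /eqP e.
    have es : x ^ t * j + i = x ^ t * j' + w %[mod s].
      have sM : s %| M by rewrite sE dvdn_gcdl.
      by rewrite -(modn_dvdm _ sM) e modn_dvdm.
    have e2 : x ^ t * j + j' == x ^ t * j' + j %[mod s].
      rewrite -dvdn_dist; apply: (@dvdn_trans (x.-1 * ((j - j') + (j' - j)))).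
        by rewrite sE dvdn_gcdr.
      have /dvdnP[q qE] : x.-1 %| (x ^ t).-1 by rewrite predn_exp dvdn_mulr.
      have xt : x ^ t = 1 + q * x.-1.
        by rewrite -qE add1n prednK // expn_gt0 x0.
      apply/dvdnP; exists q; rewrite xt.
      set y := x.-1; set A := q * y.
      have [jj|jj] := leqP j j'.
        rewrite (eqP jj) add0n mulnA -/A mulnBr.
        have : A * j <= A * j' by rewrite leq_mul2l jj orbT.
        by rewrite !mulnDl; lia.
      have jj' := ltnW jj.
      rewrite (eqP jj') addn0 mulnA -/A mulnBr.
      have : A * j' <= A * j by rewrite leq_mul2l jj' orbT.
      by rewrite !mulnDl; lia.
    apply/eqP; rewrite -(eqn_modDl (x ^ t * j')).
    set P := x ^ t * j in es e2; set Q := x ^ t * j' in es e2 *.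
    have h1 : j' + (Q + w) = j' + (P + i) %[mod s] by rewrite -modnDmr -es modnDmr.
    have h2 : i + (P + j') = i + (Q + j) %[mod s].
      by rewrite -modnDmr (eqP e2) modnDmr.
    have -> : Q + (j' + w) = j' + (Q + w) by lia.
    have -> : Q + (j + i) = i + (Q + j) by lia.
    by rewrite h1 -h2; apply/eqP; congr (_ %% _); lia.
  move=> /E eu /E ev; apply/eqP; rewrite -(eqn_modDl j') eu ev eqxx //.
apply: (@leq_trans (\sum_(i' in I') s)).
  rewrite [X in _ <= X]big_mkcond /=; apply: leq_sum => i' _; rewrite inE.
  case: ifP => [_|/negbT]; last first.
    rewrite negb_exists => /forallP n0; rewrite big1 // => t _.
    by rewrite (negbTE (n0 t)).
  rewrite -big_mkcond sum1_card -cardsE.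
  apply: leq_trans (card_exp_hits i i' M0 x0 cMx xM sE).
  by apply: eq_leq; apply: eq_card => t; rewrite !inE.
rewrite sum_nat_const; apply: (@leq_trans ((h.-1 %/ s).+1 * s)).
  by rewrite leq_mul2r I's orbT.
by rewrite mulSn addnC leq_add2r; apply: leq_trans (leq_trunc_div _ _) _; lia.
Qed.

Section Dilation.
Variables (M x h : nat) (S : {set 'I_M}).
Hypotheses (M0 : 0 < M) (hM : h <= M) (x1 : 1 < x) (cMx : coprime M x).
Hypothesis xM : forall d t, (M %| d * (x ^ t).-1) = (M %| d * (x.-1 * t)).

(** For fixed [t], the number of dilated points of [S] in the window of [h] residues ending at
    [beta]. *)
Let count (t : nat) (beta : 'I_M) : nat :=
  \sum_(j in S) \sum_(i < h) (x ^ t * j + i == beta %[mod M]).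

Lemma sum_mod_eq (u : nat) : \sum_(beta < M) (u == beta %[mod M]) = 1.
Proof.
have uM : u %% M < M by rewrite ltn_mod.
rewrite (bigD1 (Ordinal uM)) //= modn_mod eqxx big1 // => beta /negbTE nb.
apply/eqP; rewrite eqb0 (modn_small (ltn_ord beta)).
by move: nb; rewrite -val_eqE /= eq_sym => ->.
Qed.

Lemma sum_count (t : nat) : \sum_beta count t beta = #|S| * h.
Proof.
rewrite exchange_big /=; under eq_bigr => j _.
  rewrite exchange_big /=; under eq_bigr do rewrite sum_mod_eq.
  by rewrite sum1_card card_ord; over.
by rewrite sum_nat_const.
Qed.

Lemma sum_count_sqr (t : nat) : \sum_beta count t beta ^ 2 =
  \sum_(j in S) \sum_(j' in S) \sum_(i < h) \sum_(i' < h)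
     (x ^ t * j + i == x ^ t * j' + i' %[mod M]).
Proof.
under eq_bigr do rewrite -mulnn big_distrl /=.
rewrite exchange_big /=; apply: eq_bigr => j _.
under eq_bigr do rewrite big_distrr /=.
rewrite exchange_big /=; apply: eq_bigr => j' _.
under eq_bigr do rewrite big_distrl /=.
rewrite exchange_big /=; apply: eq_bigr => i _.
under eq_bigr do rewrite big_distrr /=.
rewrite exchange_big /=; apply: eq_bigr => i' _.
have uM : (x ^ t * j' + i') %% M < M by rewrite ltn_mod.
rewrite (bigD1 (Ordinal uM)) //= modn_mod eqxx muln1 big1 ?addn0 // => beta nb.
apply/eqP; rewrite muln_eq0 !eqb0 orbC -negb_and; apply/negP => /andP[/eqP e _].
by case/eqP: nb; apply: val_inj; rewrite /= e modn_small.
Qed.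

(** The first term is what equidistribution over [t] would give. The error collects the gcds, each
    at most [x.-1] times the gcd of [M] and the distance of [j] and [j']; extending [j'] to all
    residues leaves Pillai's sum. *)
Lemma sum_sum_count_sqr :
  \sum_(t < M) \sum_beta count t beta ^ 2 <=
  (#|S| * h) ^ 2 + h * (#|S| * (x.-1 * (ndiv M * M))).
Proof.
under eq_bigr do rewrite sum_count_sqr.
rewrite exchange_big /=; under eq_bigr do rewrite exchange_big /=.
pose s (j j' : 'I_M) := gcdn M (x.-1 * ((j - j') + (j' - j))).
apply: (@leq_trans (\sum_(j in S) \sum_(j' in S) h * (h + s j j'))).
  apply: leq_sum => j _; apply: leq_sum => j' _.
  rewrite exchange_big /= -[X in X * _](card_ord h) -sum_nat_const.
  by apply: leq_sum => i _; exact: (sum_exp_hits _ _ M0 (ltnW x1)).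
under eq_bigr => j _.
  under eq_bigr do rewrite mulnDr.
  rewrite big_split /= sum_nat_const -big_distrr /=; over.
rewrite big_split /= sum_nat_const -big_distrr /=.
apply: leq_add.
  by rewrite -mulnn [X in _ <= X]mulnACA !mulnA.
rewrite leq_mul2l; apply/orP; right.
rewrite -sum_nat_const; apply: leq_sum => j _.
apply: (@leq_trans (\sum_(j' < M) x.-1 * gcdn M ((j - j') + (j' - j)))).
  rewrite [X in X <= _]big_mkcond /=; apply: leq_sum => j' _; case: ifP => // _.
  have y0 : 0 < x.-1 by lia.
  rewrite /s muln_gcdr dvdn_leq ?gcdn_gt0 ?muln_gt0 ?y0 ?M0 //.
  by rewrite dvdn_gcd dvdn_gcdr andbT (dvdn_trans (dvdn_gcdl _ _)) // dvdn_mull.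
by rewrite -big_distrr /= leq_mul2l sum_gcd_dist // orbT.
Qed.

(** Second-moment method. If every dilation misses a window of length [2 * h], [count] is supported
    on at most [M - h] residues, and by Cauchy-Schwarz its second moment is too large for the bound
    summed over [t]. *)
Lemma exists_dense_dilation : x.-1 * ndiv M * M ^ 2 < #|S| * h ^ 2 ->
  exists2 t, t < M & forall beta, exists2 j : 'I_M, j \in S &
    exists2 i, i < 2 * h & x ^ t * j + i = beta %[mod M].
Proof.
move=> big_S.
pose P (t beta : 'I_M) :=
  [exists j in S, [exists i : 'I_(2 * h), x ^ t * j + i == beta %[mod M]]].
have [/existsP[t /forallP tP]|] := boolP [exists t, [forall beta, P t beta]].
  exists t => // beta; have bM : beta %% M < M by rewrite ltn_mod.
  have /exists_inP[j jS /existsP[i /eqP e]] := tP (Ordinal bM).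
  by exists j => //; exists i => //; rewrite e /= modn_mod.
rewrite negb_exists => /forallP noP; exfalso.
have hS : 0 < #|S| * h by case: (#|S|) (h) big_S => [|?] [|?] //; rewrite ?muln0.
have CS (t : 'I_M) : (#|S| * h) ^ 2 <= (M - h) * \sum_beta count t beta ^ 2.
  have := noP t; rewrite negb_forall => /existsP[beta nb].
  pose A := [set g | count t g != 0].
  have cA : #|A| <= M - h.
    (* If a window of length 2 * h is missed, so are h windows of length h. *)
    pose f (i : 'I_h) : 'I_M := Ordinal (ltn_pmod (beta + (M - i)) M0).
    have fI : injective f.
      move=> i i' /(congr1 val) /= /eqP; rewrite eqn_modDl => /eqP e.
      have iM := leq_trans (ltn_ord i) hM; have iM' := leq_trans (ltn_ord i') hM.
      apply: val_inj => /=; rewrite -(modn_small iM) -(modn_small iM').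
      rewrite -(modnDl i' M) -(modnDl i M); apply/esym.
      have -> : M + i' = M - i + (i + i') by lia.
      have -> : M + i = M - i' + (i + i') by lia.
      by rewrite -modnDml e modnDml.
    rewrite leq_subRL // -[X in _ <= X](card_ord M) -(cardC A).
    rewrite addnC leq_add2l -[X in X <= _](card_ord h) -(card_codom fI).
    apply: subset_leq_card; apply/fintype.subsetP => g /codomP[i ->].
    rewrite !inE negbK; apply/eqP; rewrite /count.
    apply: big1 => j jS; apply: big1 => i' _; apply/eqP; rewrite eqb0.
    apply: contra nb => e; apply/exists_inP; exists j => //; apply/existsP.
    have ii' : i' + i < 2 * h by have := ltn_ord i; have := ltn_ord i'; lia.
    exists (Ordinal ii'); rewrite /= addnA -(eqn_modDr (M - i)).
    have iM := leq_trans (ltn_ord i) hM.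
    rewrite -addnA subnKC; last exact: ltnW.
    by rewrite modnDr (eqP e) /= modn_mod.
  rewrite -(sum_count t) (bigID (mem A)) /= [X in _ + X]big1 ?addn0; last first.
    by move=> g; rewrite inE negbK => /eqP.
  apply: leq_trans (sqr_sum_leq _ _) _; apply: leq_mul => //.
  by rewrite [X in _ <= X](bigID (mem A)) /= leq_addr.
have : M * (#|S| * h) ^ 2 <= (M - h) * ((#|S| * h) ^ 2 + h * (#|S| * (x.-1 * (ndiv M * M)))).
  apply: leq_trans (leq_mul (leqnn _) sum_sum_count_sqr).
  rewrite big_distrr /= -[X in X * _](card_ord M) -sum_nat_const.
  by apply: leq_sum => t _; exact: CS.
apply/negP; rewrite -ltnNge.
set Q := (#|S| * h) ^ 2; set W := h * _.
(* The assumed size of [S], multiplied by [#|S| * h]: the saving [h * Q] outweighs the error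
   [M * W]. *)
have WQ : M * W < h * Q.
  have -> : M * W = #|S| * h * (x.-1 * ndiv M * M ^ 2) by rewrite /W -mulnn; lia.
  have -> : h * Q = #|S| * h * (#|S| * h ^ 2) by rewrite /Q -!mulnn; lia.
  by rewrite ltn_pmul2l.
have MhW : (M - h) * W <= M * W by rewrite leq_mul2r leq_subr orbT.
have -> : M * Q = (M - h) * Q + h * Q by rewrite -mulnDl subnK.
rewrite mulnDr ltn_add2l.
exact: leq_ltn_trans MhW WQ.
Qed.
End Dilation.

Lemma poly_lt_exp2 (C m : nat) :
  exists k0, forall k, k0 <= k -> C * k.+1 ^ m < 2 ^ k.
Proof.
case: m => [|m].
  exists C => k Ck; rewrite expn0 muln1.
  exact: leq_ltn_trans Ck (ltn_expl k _).
(* With this [D], [k + 1 <= D * 2 ^ (k / D)], and the power [m + 1] of the right side grows only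
   like [2 ^ (k / 2)]. *)
pose D := 2 * m.+1; exists (2 * (C * D ^ m.+1)) => k k0.
pose q := k %/ D.
have kq : k.+1 <= D * 2 ^ q.
  apply: leq_trans (_ : D * q.+1 <= _); first by rewrite mulnC ltn_ceil.
  by rewrite leq_mul2l ltn_expl ?orbT.
have qk : q * m.+1 <= k./2.
  have : 2 * (q * m.+1) <= k by rewrite mulnCA; exact: leq_trunc_div.
  by lia.
apply: (@leq_ltn_trans (C * D ^ m.+1 * 2 ^ k./2)).
  rewrite -mulnA leq_mul2l; apply/orP; right.
  apply: (@leq_trans ((D * 2 ^ q) ^ m.+1)); first by rewrite leq_exp2r.
  by rewrite expnMn leq_mul2l -expnM leq_pexp2l ?orbT.
have -> : 2 ^ k = 2 ^ (k - k./2) * 2 ^ k./2 by rewrite -expnD subnK //; lia.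
rewrite ltn_pmul2r ?expn_gt0 //.
by apply: leq_ltn_trans (ltn_expl (k - k./2) (isT : 1 < 2)); lia.
Qed.

(** This is [exists_dense_dilation] with window [a ^ (6 * k)]. Its condition reduces to a constant
    times the number of divisors of [a ^ (7 * k)], polynomially bounded in [k], being below
    [a ^ k]. *)
Lemma exists_dense_power (a b : nat) : 2 <= a -> 2 <= b -> coprime a b ->
  exists r k0, forall k, k0 <= k -> forall S : {set 'I_(a ^ (7 * k))},
    a ^ (3 * k) <= #|S| ->
    exists2 t, t < a ^ (7 * k) & forall beta, exists2 j : 'I_(a ^ (7 * k)), j \in S &
    exists2 i, i < 2 * a ^ (6 * k) & b ^ (r * t) * j + i = beta %[mod a ^ (7 * k)].
Proof.
(* By Euler's theorem [b ^ r] is 1 modulo [a ^ 2], as lifting the exponent requires. *)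
move=> a2 b2 cab; pose r := totient (a ^ 2); pose x := b ^ r.
have a0 : 0 < a by exact: ltnW.
have r0 : 0 < r by rewrite totient_gt0 expn_gt0 a0.
have x1 : 1 < x by rewrite -(exp1n r) ltn_exp2r.
have ax : a ^ 2 %| x.-1.
  rewrite -subn1 -eqn_mod_dvd; last exact: ltnW.
  by apply/eqP; apply: Euler_exp_totient; rewrite coprime_sym coprimeXl.
have [k0 k0P] := poly_lt_exp2 (x.-1 * 7 ^ a) a.
exists r, k0 => k /k0P kP S cS.
have M0 : 0 < a ^ (7 * k) by rewrite expn_gt0 a0.
have hM : a ^ (6 * k) <= a ^ (7 * k) by rewrite leq_pexp2l // leq_mul2r orbT.
have cMx : coprime (a ^ (7 * k)) x by rewrite /x coprimeXl // coprimeXr.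
have [] := @exists_dense_dilation _ x _ S M0 hM x1 cMx.
- by move=> d t; apply: dvdn_mul_predn_exp.
- apply: (@leq_trans (a ^ (3 * k) * (a ^ (6 * k)) ^ 2)); last by rewrite leq_mul2r cS orbT.
  have -> : a ^ (3 * k) * (a ^ (6 * k)) ^ 2 = a ^ k * (a ^ (7 * k)) ^ 2.
    by rewrite -!expnM -!expnD; congr (_ ^ _); lia.
  have M20 : 0 < (a ^ (7 * k)) ^ 2 by rewrite expn_gt0 M0.
  rewrite ltn_pmul2r //.
  apply: leq_trans (_ : 2 ^ k <= _); last by case: (k) => // k'; rewrite leq_exp2r.
  apply: leq_ltn_trans kP; rewrite -mulnA leq_mul2l; apply/orP; right.
  apply: leq_trans (ndiv_expn _ a0) _; rewrite -expnMn leq_exp2r //; lia.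
move=> t tM H; exists t => // beta; have [j jS [i ih e]] := H beta.
by exists j => //; exists i => //; rewrite expnM.
Qed.

(** Induction on the number of base-[L] digits above [G]. If dropping the top digit leaves at most
    [G * mu ^ B] numbers, some remainder [w] is shared by more than [mu] elements of [Z], whose top
    digits then differ; otherwise recurse on the remainders. *)
Lemma exists_large_block (G L mu B : nat) (Z : seq nat) :
    0 < G -> 0 < L -> uniq Z -> {in Z, forall z, z < G * L ^ B} ->
    G * mu ^ B < size Z ->
  exists2 i, i < B & exists w, exists2 S : {set 'I_L}, mu < #|S| &
    forall j, j \in S -> exists2 z, z \in Z & z = j * (G * L ^ i) + w %[mod G * L ^ i.+1].
Proof.
move=> G0 L0; elim: B Z => [|B IHB] Z uZ ltZ szZ.
  move: szZ; rewrite !expn0 !muln1 in ltZ *.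
  rewrite ltnNge -[X in _ <= X](size_iota 0) uniq_leq_size // => z /ltZ.
  by rewrite mem_iota.
pose H := G * L ^ B; have H0 : 0 < H by rewrite muln_gt0 G0 expn_gt0 L0.
pose Z' := undup (map (modn^~ H) Z).
have [szZ'|szZ'] := ltnP (G * mu ^ B) (size Z').
  have [|i iB [w [S muS SP]]] := IHB Z' (undup_uniq _) _ szZ'.
    by move=> z; rewrite mem_undup => /mapP[u _ ->]; rewrite ltn_mod.
  exists i; first exact: ltnW.
  exists w, S => // j /SP[z']; rewrite mem_undup => /mapP[z zZ ->] zE.
  exists z => //; rewrite -zE modn_dvdm // dvdn_mul // dvdn_exp2l //.
have [w wZ' wP] : exists2 w, w \in Z' & mu < count (fun z => z %% H == w) Z.
  apply/hasP/negPn/negP => /hasPn le_mu; move: szZ; apply/negP; rewrite -leqNgt.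
  apply: (@leq_trans (size Z' * mu)); last first.
    by rewrite expnSr mulnA leq_mul2r szZ' orbT.
  apply: (@leq_trans (\sum_(w <- Z') count (fun z => z %% H == w) Z)); last first.
    rewrite big_seq -sum1_size big_distrl /= [X in _ <= X]big_seq.
    by apply: leq_sum => w /le_mu; rewrite -leqNgt mul1n.
  under eq_bigr do rewrite -sum1_count big_mkcond.
  rewrite exchange_big /= -sum1_size big_seq [X in _ <= X]big_seq.
  apply: leq_sum => z zZ; have zZ' : z %% H \in Z' by rewrite mem_undup; apply/mapP; exists z.
  by rewrite (big_rem _ zZ') /= eqxx.
pose digits := [seq z %/ H | z <- Z & z %% H == w].
have udig : uniq digits.
  rewrite map_inj_in_uniq ?filter_uniq // => u v.
  rewrite !mem_filter => /andP[/eqP uw _] /andP[/eqP vw _] uv.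
  by rewrite (divn_eq u H) (divn_eq v H) uw vw uv.
exists B => //; exists w, [set j : 'I_L | val j \in digits].
  rewrite -size_filter -(size_map (divn^~ H)) -/digits in wP.
  apply: leq_trans wP _.
  rewrite cardE -(size_map val); apply: uniq_leq_size => // d dD.
  have dL : d < L.
    case/mapP: dD => z; rewrite mem_filter => /andP[_ zZ] ->.
    by rewrite ltn_divLR // mulnC -mulnA -expnSr ltZ.
  by apply/mapP; exists (Ordinal dL) => //; rewrite mem_enum inE.
move=> j; rewrite inE => /mapP[z]; rewrite mem_filter => /andP[/eqP zw zZ] ->.
by exists z => //; rewrite -zw -divn_eq.
Qed.

(** * Dilating a set of reals that meets many cells *)

Local Open Scope classical_set_scope.
Local Open Scope ring_scope.

Lemma eqmod_intD (R : comNzRingType) (m n d : nat) :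
  m = n %[mod d] -> exists u : int, m%:R = n%:R + u%:~R * d%:R :> R.
Proof.
move=> mn; exists ((m %/ d)%N%:Z - (n %/ d)%N%:Z).
have -> : m%:R = (m %/ d)%N%:R * d%:R + (m %% d)%N%:R :> R.
  by rewrite -natrM -natrD -divn_eq.
have -> : n%:R = (n %/ d)%N%:R * d%:R + (m %% d)%N%:R :> R.
  by rewrite -natrM -natrD mn -divn_eq.
by rewrite rmorphB /=; ring.
Qed.

Lemma exists_nat_eqmod (R : comNzRingType) (m : int) (d : nat) : (0 < d)%N ->
  exists (n : nat) (u : int), n%:R = m%:~R + u%:~R * d%:R :> R.
Proof.
move=> d0; exists (absz (m %% d)%Z), (- (m %/ d)%Z).
have d0' : d%:Z != 0 by rewrite -lt0n.
have -> : m%:~R = (m %/ d)%Z%:~R * d%:R + (m %% d)%Z%:~R :> R.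
  by rewrite {1}(divz_eq m d) rmorphD rmorphM.
rewrite -[LHS]/((absz (m %% d)%Z)%:~R) gez0_abs ?modz_ge0 // rmorphN /=; ring.
Qed.

(* e = E * a ^ (7 * k) blocks of 7 * k base-a digits, followed by e further digits
   that absorb the error amplified by a power of b. *)
Definition cells (a E k : nat) : nat := (a ^ (E * a ^ (7 * k) * (7 * k).+1))%N.

(** Block [i] supplies the digit set [S]; multiplying by [a ^ s] moves it to the front, and a power
    of [b] makes it dense. The lower digits are a common [w], a known shift that can be subtracted
    from the target. *)
Lemma dilate_large_cellset (R : realType) (a b : nat) :
    (2 <= a)%N -> (2 <= b)%N -> coprime a b ->
  exists E k0 : nat, (0 < E)%N /\ forall (k : nat) (N := cells a E k),
    (k0 <= k)%N -> forall (P : R -> Prop) (Z : seq nat), uniq Z ->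
    {in Z, forall z, (z < N)%N /\ exists2 x, P x &
      exists c : int, z%:R <= N%:R * (x - c%:~R) < z%:R + 1} ->
    (N <= 2 * size Z ^ 2)%N ->
  forall beta : R, exists2 x, P x & exists s t : nat, exists2 c : int,
    (a ^ s * b ^ t <= N ^ 2)%N &
    `|(a ^ s * b ^ t)%:R * x - beta - c%:~R| <= 2 / a%:R ^+ k.
Proof.
move=> a2 b2 cab; have [r [k1 k1P]] := exists_dense_power a2 b2 cab.
(* This [E] makes the [e] trailing digits outweigh the power of [b], as
   [b ^ (r * t) <= a ^ (b * r * t)] with [t < L]; [k >= 3] serves the count of [Z] below. *)
exists (b * r).+1, (maxn k1 3); split=> // k N; set L := (a ^ (7 * k))%N; pose e := ((b * r).+1 * L)%N.
rewrite geq_max => /andP[/k1P {k1 k1P} Sdense k3] P Z uZ ZP szZ beta.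
have a0 : (0 < a)%N by exact: ltnW.
have L0 : (0 < L)%N by rewrite expn_gt0 a0.
have e0 : (0 < e)%N by rewrite muln_gt0 L0.
have NE : N = (a ^ e * L ^ e)%N.
  by rewrite /N /cells -/L -/e /L -expnM -expnD; congr (_ ^ _)%N; lia.
have G0 : (0 < a ^ e)%N by rewrite expn_gt0 a0.
have [||i ie [w [S cS SP]]] :=
    @exists_large_block (a ^ e) L (a ^ (3 * k)) e Z G0 L0 uZ.
- by move=> z /ZP[zN _]; rewrite -NE.
(* After squaring, the exponents [2 * e * (3 * k + 1)] and [e * (7 * k + 1)] are compared; the
   excess [e * (k - 1)] absorbs the factor 2. *)
- rewrite -(ltn_exp2r _ _ (isT : 0 < 2)%N) -(ltn_pmul2l (isT : 0 < 2)%N).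
  apply: leq_trans szZ; rewrite /N /cells -/L -/e -expnM -expnD -expnM.
  have -> : (e * (7 * k).+1 = e * (k - 1) + (e + 3 * k * e) * 2)%N by lia.
  rewrite expnD ltn_pmul2r ?expn_gt0 ?a0 //.
  apply: (@leq_trans (a ^ 2)%N); last by rewrite leq_pexp2l //; nia.
  by rewrite (@leq_trans (2 ^ 2)%N) // leq_exp2r.
have {Sdense} [t tL tP] := Sdense S (ltnW cS).
pose T := (b ^ (r * t))%N; pose H := (a ^ e * L ^ i)%N.
(* [a ^ s] is [L ^ (e - i - 1)]: it shifts the blocks above [i] into the integer part. *)
pose s := (7 * k * (e - i.+1))%N.
have sH : N = (a ^ s * H * L)%N.
  by rewrite NE /H /L /s -!expnM -!expnD; congr (_ ^ _)%N; nia.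
have TG : (T * L <= a ^ e)%N.
  rewrite /e mulSn expnD mulnC; apply: leq_mul; first exact: ltnW (ltn_expl _ a2).
  rewrite -mulnA expnM; apply: (@leq_trans ((a ^ b) ^ (r * t))%N).
    have bab : (b <= a ^ b)%N by exact: ltnW (ltn_expl _ a2).
    by rewrite /T; case: (r * t)%N => // n; rewrite leq_exp2r.
  by rewrite leq_pexp2l ?expn_gt0 ?a0 // leq_mul2l (ltnW tL) orbT.
(* The target in units of [1 / L], less the contribution of the common lower digits. *)
pose gamma : R := L%:R * beta - T%:R * w%:R / H%:R.
have [n [v nE]] := exists_nat_eqmod R (Num.floor gamma) L0.
have [j jS [i' ih jn]] := tP n.
have [z zZ zE] := SP j jS.
have [zN [x Px [c /andP[zx xz]]]] := ZP z zZ.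
exists x => //; exists s, (r * t)%N.
have {}zE : z = j * H + w %[mod H * L] by rewrite /H -mulnA -expnSr.
have [u uE] := eqmod_intD R zE.
have [v' v'E] := eqmod_intD R jn; rewrite -/T -/L in v'E.
have ihR : i'%:R <= 2 * a%:R ^+ (6 * k) - 1 :> R.
  by rewrite lerBrDr -natrX -natrM natr1 ler_nat.
have LR : L%:R = a%:R ^+ k * a%:R ^+ (6 * k) :> R.
  by rewrite -exprD natrX; congr (_ ^+ _); lia.
have TLH : T%:R * L%:R <= H%:R :> R.
  rewrite -natrM ler_nat; apply: leq_trans TG _.
  by rewrite leq_pmulr // expn_gt0 L0.
have T0 : 0 < T%:R :> R by rewrite ltr0n expn_gt0; lia.
have L0R : 0 < L%:R :> R by rewrite ltr0n.
have H0 : 0 < H%:R :> R by rewrite ltr0n muln_gt0 G0 expn_gt0 L0.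
have A0 : 0 < (a ^ s)%:R :> R by rewrite ltr0n expn_gt0 a0.
have B0 : 0 < a%:R ^+ k :> R by rewrite exprn_gt0 // ltr0n.
have C0 : 0 < a%:R ^+ (6 * k) :> R by rewrite exprn_gt0 // ltr0n.
exists (T%:Z * ((a ^ s)%N%:Z * c + u) + (v + v')).
  have aN : (a ^ s <= N)%N.
    by rewrite sH -mulnA leq_pmulr // !muln_gt0 G0 expn_gt0 L0.
  have bN : (b ^ (r * t) <= N)%N.
    apply: (@leq_trans (a ^ e)%N); last by rewrite NE leq_pmulr // expn_gt0 L0.
    by apply: leq_trans TG; rewrite leq_pmulr.
  by rewrite -mulnn leq_mul.
rewrite -/T; clearbody H T.
pose th := N%:R * (x - c%:~R) - z%:R.
have th0 : 0 <= th by rewrite /th subr_ge0.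
have th1 : th < 1 by rewrite /th ltrBlDl.
have fl0 := Num.Theory.floor_le gamma; have fl1 := Num.Theory.floorD1_gt gamma.
rewrite rmorphD /= in fl1.
set m := Num.floor gamma in nE fl0 fl1.
have NR : N%:R = (a ^ s)%:R * H%:R * L%:R :> R by rewrite sH !natrM.
rewrite !natrD !natrM in uE; rewrite !natrD !natrM in v'E.
have xE : x = c%:~R + (th + z%:R) / N%:R.
  have N0 : N%:R != 0 :> R by rewrite NR !mulf_neq0 ?gt_eqF.
  by rewrite /th subrK mulrAC divff // mul1r subrKC.
have jE : j%:R = (m%:~R + v%:~R * L%:R + v'%:~R * L%:R - i'%:R) / T%:R :> R.
  by rewrite -nE -v'E; field; rewrite gt_eqF.
(* The three errors: rounding [gamma], the offset [i'], and the position [th] inside the cell,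
   magnified by [T] but damped by [H >= T * L]. *)
have -> : (a ^ s * T)%:R * x - beta -
    (T%:Z * ((a ^ s)%N%:Z * c + u) + (v + v'))%:~R =
    ((m%:~R - gamma) - i'%:R + T%:R * th / H%:R) / L%:R.
  rewrite natrM xE NR uE jE /gamma !rmorphD !rmorphM /= !rmorphD !rmorphM /=.
  rewrite -!pmulrn; field.
  by rewrite !gt_eqF.
have -> : 2 / a%:R ^+ k = 2 * a%:R ^+ (6 * k) / L%:R :> R.
  by rewrite LR; field; rewrite !gt_eqF.
rewrite normrM normfV (gtr0_norm L0R) ler_pM2r ?invr_gt0 //.
have i0 : 0 <= i'%:R :> R by [].
have th_T0 : 0 <= T%:R * th / H%:R by rewrite divr_ge0 ?mulr_ge0 // ltW.
have th_T1 : T%:R * th / H%:R <= 1.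
  rewrite ler_pdivrMr // mul1r; apply: le_trans TLH.
  apply: ler_wpM2l; first exact: ltW.
  by apply: le_trans (ltW th1) _; rewrite ler1n.
have C1 : 1 <= a%:R ^+ (6 * k) :> R by rewrite -natrX ler1n expn_gt0 a0.
by rewrite ler_norml; apply/andP; split; lra.
Qed.

(** * Many cells met by the orbit *)

(** With [b ^ v] the largest power of [b] up to [a ^ u], the ratios [a ^ u / b ^ v] lie in [[1, b)];
    among [b * J + 1] of them two differ by less than [1 / J]. Clearing denominators gives [A] and
    [B], distinct because [a] and [b] are coprime. *)
Lemma exists_close_pair (a b J : nat) :
    (2 <= a)%N -> (2 <= b)%N -> coprime a b -> (0 < J)%N ->
  exists A B : nat, [/\ Sigma a b A, Sigma a b B, (B < A)%N,
    (J * (A - B) <= B)%N & (A <= a ^ (2 * b * J))%N].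
Proof.
move=> a2 b2 cab J0; have a0 : (0 < a)%N by exact: ltnW.
have b0 : (0 < b)%N by exact: ltnW.
pose v u := trunc_log b (a ^ u).
have vP u : (b ^ v u <= a ^ u < b ^ (v u).+1)%N.
  by apply: trunc_log_bounds; rewrite // expn_gt0 a0.
have fP u : (J * a ^ u %/ b ^ v u < b * J)%N.
  rewrite ltn_divLR ?expn_gt0 ?b0 // mulnAC -expnS mulnC ltn_pmul2r //.
  by case/andP: (vP u).
pose f (u : 'I_(b * J).+1) := Ordinal (fP u).
have /injectivePn[u0 [u1 u01 f01]] : ~~ injectiveb f.
  apply/negP => /injectiveP /leq_card; rewrite !card_ord ltnn //.
wlog lt01 : u0 u1 u01 f01 / (u0 < u1)%N.
  move=> W; have [h|h] := ltnP u0 u1; first exact: W f01 h.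
  apply: (W u1 u0) => //; first by rewrite eq_sym.
  by rewrite ltn_neqAle h andbT val_eqE eq_sym.
move/(congr1 val): f01 => /= f01.
set v0 := v u0 in f01; set v1 := v u1 in f01.
have /andP[l0 _] := vP u0; have /andP[l1 _] := vP u1; rewrite -/v0 -/v1 in l0 l1.
(* [X / V] and [Y / V] are the two colliding ratios. *)
pose X := (a ^ u0 * b ^ v1)%N; pose Y := (a ^ u1 * b ^ v0)%N; pose V := (b ^ v0 * b ^ v1)%N.
have VX : (V <= X)%N by rewrite leq_mul2r l0 orbT.
have VY : (V <= Y)%N by rewrite /V mulnC leq_mul2r l1 orbT.
have bv w : (0 < b ^ w)%N by rewrite expn_gt0 b0.
have XY1 : (J * X < J * Y + V)%N.
  have := ltn_ceil (J * a ^ u0) (bv v0).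
  have := leq_trunc_div (J * a ^ u1) (b ^ v1); rewrite f01 /X /Y /V.
  have := bv v0; have := bv v1.
  move: (b ^ v0)%N (b ^ v1)%N (a ^ u0)%N (a ^ u1)%N (_ %/ _)%N => p0 p1 q0 q1 g.
  nia.
have XY2 : (J * Y < J * X + V)%N.
  have := ltn_ceil (J * a ^ u1) (bv v1).
  have := leq_trunc_div (J * a ^ u0) (b ^ v0); rewrite f01 /X /Y /V.
  have := bv v0; have := bv v1.
  move: (b ^ v0)%N (b ^ v1)%N (a ^ u0)%N (a ^ u1)%N (_ %/ _)%N => p0 p1 q0 q1 g.
  nia.
have nXY : X <> Y.
  rewrite /X /Y -(subnKC (ltnW lt01)) expnD -mulnA => /eqP.
  rewrite eqn_pmul2l ?expn_gt0 ?a0 // => /eqP e.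
  have : (a %| b ^ v1)%N by rewrite e -(prednK (n := u1 - u0)) ?subn_gt0 // expnS -mulnA dvdn_mulr.
  have cabv : coprime a (b ^ v1) by rewrite coprimeXr.
  by move=> av; have : (a %| 1)%N; [rewrite -(eqP cabv) dvdn_gcd dvdnn|rewrite dvdn1; lia].
have aW : (a ^ u0 * a ^ u1 <= a ^ (2 * b * J))%N.
  rewrite -expnD leq_pexp2l //.
  by have := ltn_ord u0; have := ltn_ord u1; rewrite !ltnS; lia.
have XW : (X <= a ^ (2 * b * J))%N by apply: leq_trans aW; rewrite leq_mul2l l1 orbT.
have YW : (Y <= a ^ (2 * b * J))%N.
  by apply: leq_trans aW; rewrite /Y mulnC leq_mul2r l0 orbT.
have SX : Sigma a b X by exists u0, v1.
have SY : Sigma a b Y by exists u1, v0.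
have [XY|YX] := ltnP X Y.
  by exists Y, X; split=> //; rewrite mulnBr; lia.
by exists X, Y; split=> //; [lia | rewrite mulnBr; lia].
Qed.

(** Dirichlet's argument: the fractional parts of [n + 1] values fall into [n] intervals of length
    [1 / n]. *)
Lemma pigeonhole_mod1 (R : realType) (n : nat) (f : nat -> R) : (0 < n)%N ->
  exists i j : nat, (i < j <= n)%N /\ exists c : int, `|f j - f i - c%:~R| < n%:R^-1.
Proof.
move=> n0; pose fr i := f i - (Num.floor (f i))%:~R.
have n0R : 0 < n%:R :> R by rewrite ltr0n.
have fr0 i : 0 <= fr i by rewrite subr_ge0 Num.Theory.floor_le.
have fr1 i : fr i < 1.
  by rewrite ltrBlDl; have := Num.Theory.floorD1_gt (f i); rewrite rmorphD /= addrC.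
pose g i := Num.truncn (n%:R * fr i).
have gP i : (g i)%:R <= n%:R * fr i < (g i).+1%:R.
  by apply: Num.Theory.truncn_itv; rewrite mulr_ge0 // ltW.
have gn i : (g i < n)%N.
  rewrite -(ltr_nat R); have /andP[+ _] := gP i; move=> /le_lt_trans; apply.
  by rewrite gtr_pMr.
pose G (i : 'I_n.+1) := Ordinal (gn i).
have /injectivePn[i [j ij Gij]] : ~~ injectiveb G.
  by apply/negP => /injectiveP /leq_card; rewrite !card_ord ltnn.
wlog lt_ij : i j ij Gij / (i < j)%N.
  move=> W; have [h|h] := ltnP i j; first exact: W Gij h.
  apply: (W j i) => //; first by rewrite eq_sym.
  by rewrite ltn_neqAle h andbT val_eqE eq_sym.
exists i, j; split; first by rewrite lt_ij -ltnS /=.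
exists (Num.floor (f j) - Num.floor (f i)).
have -> : f j - f i - (Num.floor (f j) - Num.floor (f i))%:~R = fr j - fr i.
  by rewrite rmorphB /= /fr; ring.
move/(congr1 val): Gij => /= e.
have /andP[l1 r1] := gP i; have /andP[l2 r2] := gP j; rewrite e in l1 r1.
rewrite -(ltr_pM2l n0R) divff ?gt_eqF // -{1}(gtr0_norm n0R) -normrM mulrBr.
rewrite -!natr1 in r1 r2; by rewrite ltr_norml; apply/andP; split; lra.
Qed.

(** * Diophantine approximation of [alpha] *)

Lemma irrational_mul_neq (R : realType) (alpha : R) (k : nat) (l : int) :
  irrational alpha -> (0 < k)%N -> k%:R * alpha - l%:~R != 0.
Proof.
move=> ia k0; apply/eqP => /subr0_eq e; apply: ia.
have kR : k%:R != 0 :> R by rewrite pnatr_eq0 -lt0n.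
exists (l%:~R / k%:R) => //.
by rewrite rmorphM /= fmorphV /= ratr_int ratr_nat -e mulrC mulKf.
Qed.

(** By irrationality the nearest-integer distance is positive for each of the finitely many [k].
    This forces a Dirichlet denominator for [Q] to exceed [X]. *)
Lemma irrational_dist_lb (R : realType) (alpha : R) (X : nat) : irrational alpha ->
  exists2 Q : nat, (0 < Q)%N & forall k l, (0 < k <= X)%N ->
    Q%:R^-1 <= `|k%:R * alpha - l%:~R|.
Proof.
move=> ia; elim: X => [|X [Q Q0 QP]].
  by exists 1%N => // -[|k] l.
have [[m mE] dist_le] := dist_int_min (X.+1%:R * alpha).
have d0 : 0 < dist_int (X.+1%:R * alpha).
  by rewrite mE normr_gt0 irrational_mul_neq.
pose Q' := (Num.truncn (dist_int (X.+1%:R * alpha))^-1).+1.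
exists (maxn Q Q'); first by rewrite leq_max Q0.
move=> k l /andP[k0]; rewrite leq_eqVlt => /predU1P[->|kX].
  apply: le_trans (dist_le l); rewrite invf_ple ?posrE ?ltr0n ?leq_max ?Q0 //.
  apply: ltW; apply: lt_le_trans (Num.Theory.truncnS_gt _) _.
  by rewrite ler_nat leq_maxr.
apply: le_trans (QP k l _); last by rewrite k0.
by rewrite lef_pV2 ?posrE ?ltr0n ?leq_max ?Q0 // ler_nat leq_maxl.
Qed.

(** Dirichlet's theorem in lowest terms: dividing numerator and denominator by their gcd only
    shrinks the error. *)
Lemma dirichlet_coprime (R : realType) (alpha : R) (Q : nat) : (0 < Q)%N ->
  exists (D : nat) (m : int), [/\ (0 < D <= Q)%N, coprime D `|m|%N &
    `|D%:R * alpha - m%:~R| < Q%:R^-1].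
Proof.
move=> Q0; have [i [j [/andP[ij jQ] [c cP]]]] := pigeonhole_mod1 (fun i => i%:R * alpha) Q0.
rewrite -mulrBl -natrB ?(ltnW ij) // in cP.
pose k := (j - i)%N; pose g := gcdn k `|c|%N.
have k0 : (0 < k)%N by rewrite subn_gt0.
have g0 : (0 < g)%N by rewrite gcdn_gt0 k0.
have gk : (g %| k)%N by rewrite dvdn_gcdl.
have gc : (g%:Z %| c)%Z by rewrite dvdzE; exact: dvdn_gcdr.
exists (k %/ g)%N, (c %/ g%:Z)%Z; split.
- rewrite divn_gt0 // dvdn_leq //= (leq_trans (leq_div _ _)) //.
  exact: leq_trans (leq_subr _ _) jQ.
- rewrite /coprime -(eqn_pmul2r g0) mul1n muln_gcdl divnK //.
  have -> : (`|(c %/ g%:Z)%Z| * g = `|c|)%N.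
    by rewrite -[g in LHS]/(`|g%:Z|%N) -abszM divzK.
  by [].
apply: le_lt_trans cP.
have -> : (j - i)%N%:R * alpha - c%:~R =
    g%:R * ((k %/ g)%N%:R * alpha - (c %/ g%:Z)%Z%:~R).
  rewrite mulrBr mulrA -natrM [(g * _)%N]mulnC divnK // -/k; congr (_ - _).
  by rewrite -{1}(divzK gc) rmorphM /= mulrC.
by rewrite normrM ger0_norm // ler_peMl // ler1n.
Qed.

(** [k * m - D * l] is nonzero since [D] cannot divide [k], so it has absolute value at least 1;
    replacing [m] by [D * alpha] costs at most [k / D <= 1 / 2]. *)
Lemma coprime_approx_dist_lb (R : realType) (alpha : R) (D : nat) (m : int) :
    coprime D `|m|%N -> `|D%:R * alpha - m%:~R| <= D%:R^-1 ->
  forall (k : nat) (l : int), (0 < k)%N -> (2 * k <= D)%N ->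
  (2 * D%:R)^-1 <= `|k%:R * alpha - l%:~R|.
Proof.
move=> cop near k l k0 kD.
have D0 : 0 < D%:R :> R by rewrite ltr0n; lia.
have nz : k%:Z * m - D%:Z * l != 0.
  apply/eqP => /subr0_eq e.
  have : (D %| k * `|m|)%N.
    by rewrite -[k]/(`|k%:Z|%N) -abszM e abszM dvdn_mulr.
  by rewrite Gauss_dvdl // => /dvdn_leq; lia.
have ge1 : 1 <= `|k%:R * m%:~R - D%:R * l%:~R| :> R.
  have -> : k%:R * m%:~R - D%:R * l%:~R = (k%:Z * m - D%:Z * l)%:~R :> R.
    by rewrite rmorphB !rmorphM /= !pmulrn.
  by rewrite -intr_norm -[1]/(1%:~R) ler_int -gtz0_ge1 normr_gt0.
have E : k%:R * m%:~R - D%:R * l%:~R =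
    D%:R * (k%:R * alpha - l%:~R) - k%:R * (D%:R * alpha - m%:~R) by ring.
have kDR : 2 * k%:R <= D%:R :> R by rewrite -natrM ler_nat.
have h : k%:R * `|D%:R * alpha - m%:~R| <= 2^-1.
  apply: (@le_trans _ _ (k%:R * D%:R^-1)); first by rewrite ler_wpM2l.
  by rewrite ler_pdivrMr //; lra.
have := ler_normB (D%:R * (k%:R * alpha - l%:~R)) (k%:R * (D%:R * alpha - m%:~R)).
rewrite -E !normrM !normr_nat => tri.
rewrite invfM ler_pdivrMr // mulrC; lra.
Qed.

(** Pigeonhole on the powers from [a ^ n] to [a ^ (2 * n)] gives the upper bound; the lower bound
    comes from a Dirichlet denominator [D] at least twice these powers. The order of the two
    exponents is chosen to make the difference positive. *)
Lemma exists_small_difference (R : realType) (a : nat) (alpha : R) :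
    (2 <= a)%N -> irrational alpha -> forall n0 : nat,
  exists2 n, (n0 <= n)%N & exists u u' : nat, [/\ (n <= u <= 2 * n)%N,
    (n <= u' <= 2 * n)%N & exists c : int,
    (a%:R ^+ (2 * n + 4))^-1 <= (a ^ u)%:R * alpha - (a ^ u')%:R * alpha - c%:~R < n%:R^-1].
Proof.
move=> a2 ia n0; have a0 : (0 < a)%N by exact: ltnW.
have [Q Q0 QP] := irrational_dist_lb (2 * a ^ (2 * n0.+1)) ia.
have [D [m [/andP[D0 DQ] cop near]]] := dirichlet_coprime alpha Q0.
have DX : (2 * a ^ (2 * n0.+1) < D)%N.
  rewrite ltnNge; apply/negP => DX.
  by have := QP D m; rewrite D0 DX => /(_ isT); rewrite leNgt near.
have ex : exists n, (2 * a ^ (2 * n) <= D)%N by exists n0.+1; exact: ltnW.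
have bd n : (2 * a ^ (2 * n) <= D)%N -> (n <= D)%N.
  move=> nD; apply: leq_trans nD; apply: leq_trans (ltnW (ltn_expl n a2)) _.
  by apply: (@leq_trans (a ^ (2 * n))); [rewrite leq_pexp2l // leq_pmull | rewrite leq_pmull].
(* Maximality of [n] puts [2 * D] below [4 * a ^ (2 * n + 2) <= a ^ (2 * n + 4)]. *)
case: (ex_maxnP ex bd) => n nD nmax.
have n0n : (n0 < n)%N by apply: nmax; exact: ltnW.
have Dn : (D < 2 * a ^ (2 * n.+1))%N.
  by rewrite ltnNge; apply/negP => /nmax; rewrite ltnn.
exists n; first exact: ltnW.
have n_gt0 : (0 < n)%N by apply: leq_ltn_trans n0n.
have [i [j [/andP[ij jn] [c cP]]]] :=
  pigeonhole_mod1 (fun i => (a ^ (n + i))%:R * alpha) n_gt0.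
pose k := (a ^ (n + j) - a ^ (n + i))%N.
have k0 : (0 < k)%N by rewrite subn_gt0 ltn_exp2l // ltn_add2l.
have kD : (2 * k <= D)%N.
  apply: leq_trans nD; rewrite leq_mul2l /=; apply: leq_trans (leq_subr _ _) _.
  by rewrite leq_pexp2l //; lia.
have nearD : `|D%:R * alpha - m%:~R| <= D%:R^-1.
  by apply: le_trans (ltW near) _; rewrite lef_pV2 ?posrE ?ltr0n // ler_nat.
have := coprime_approx_dist_lb cop nearD c k0 kD.
have -> : k%:R * alpha - c%:~R =
    (a ^ (n + j))%:R * alpha - (a ^ (n + i))%:R * alpha - c%:~R.
  by rewrite natrB ?mulrBl // leq_pexp2l // leq_add2l ltnW.
move=> lb.
have {}lb : (a%:R ^+ (2 * n + 4))^-1 <=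
    `|(a ^ (n + j))%:R * alpha - (a ^ (n + i))%:R * alpha - c%:~R|.
  apply: le_trans lb; rewrite lef_pV2 ?posrE ?exprn_gt0 ?mulr_gt0 ?ltr0n //.
  rewrite -natrM -natrX ler_nat; apply: (@leq_trans (2 * (2 * a ^ (2 * n.+1)))).
    by rewrite leq_mul2l ltnW.
  rewrite mulnA (_ : (2 * n + 4 = 2 + 2 * n.+1)%N); last by lia.
  by rewrite expnD leq_mul2r (leq_exp2r 2 a (isT : 0 < 2)%N) a2 orbT.
have iP : (n <= n + i <= 2 * n)%N by lia.
have jP : (n <= n + j <= 2 * n)%N by lia.
have [s0|s0] := ger0P ((a ^ (n + j))%:R * alpha - (a ^ (n + i))%:R * alpha - c%:~R).
  exists (n + j)%N, (n + i)%N; split=> //; exists c.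
  by rewrite ger0_norm // in lb cP; rewrite lb cP.
exists (n + i)%N, (n + j)%N; split=> //; exists (- c).
rewrite ltr0_norm // in lb cP.
rewrite rmorphN /=.
have -> : (a ^ (n + i))%:R * alpha - (a ^ (n + j))%:R * alpha - - c%:~R =
  - ((a ^ (n + j))%:R * alpha - (a ^ (n + i))%:R * alpha - c%:~R) by ring.
by rewrite lb cP.
Qed.

(** * Orbit differences going round the circle *)

Lemma exists_expn_between (R : realType) (a : nat) (x y : R) :
  (2 <= a)%N -> 0 < x -> x <= y ->
  exists s, x * a%:R ^+ s <= y < x * a%:R ^+ s.+1.
Proof.
move=> a2 x0 xy.
have ex : exists s, x * a%:R ^+ s <= y by exists 0%N; rewrite expr0 mulr1.
have bd s : x * a%:R ^+ s <= y -> (s <= Num.truncn (y / x))%N.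
  rewrite mulrC -ler_pdivlMr // => h.
  have : s%:R < y / x.
    by apply: lt_le_trans h; rewrite -natrX ltr_nat ltn_expl.
  by move=> /ltW; rewrite -Num.Theory.truncn_ge_nat // ltW // divr_gt0 // (lt_le_trans x0).
case: (ex_maxnP ex bd) => s sP smax; exists s; rewrite sP /= ltNge.
by apply/negP => /smax; rewrite ltnn.
Qed.

(** A rise by at most 1 skips no integer on the way up; falls may be arbitrary. *)
Lemma int_path_ivt (G : nat -> int) (J : nat) :
    (forall j, (j < J)%N -> G j.+1 <= G j + 1) ->
  forall m : int, G 0%N <= m <= G J -> exists2 j, (j <= J)%N & G j = m.
Proof.
elim: J => [|J IHJ] step m /andP[G0 GJ].
  by exists 0%N => //; apply/eqP; rewrite eq_le G0 GJ.
have [mJ|Jm] := leP m (G J).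
  have stepJ j : (j < J)%N -> G j.+1 <= G j + 1 by move=> /ltnW; exact: step.
  have [|j jJ Gj] := IHJ stepJ m; first by rewrite G0 mJ.
  by exists j => //; exact: leqW.
exists J.+1 => //; apply/eqP; rewrite eq_le GJ andbT.
by apply: le_trans (step J _) _ => //; rewrite lezD1.
Qed.

(** The numbers [Q j * d] sweep the circle with rises of at most [1 / N], so their cells exhaust the
    residues modulo [N]. As [Q j * d] is [Q j * x - Q j * y] modulo 1, each residue is a difference
    of two cells in [Z] up to a rounding of 0 or 1. *)
Lemma large_cellset (R : realType) (N J : nat) (Q : nat -> nat) (x y d : R) (c : int) :
    (0 < N)%N -> x - y = d + c%:~R ->
    (forall j, (j < J)%N -> d * ((Q j.+1)%:R - (Q j)%:R) <= N%:R^-1) ->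
    1 <= d * ((Q J)%:R - (Q 0%N)%:R) ->
  exists Z : seq nat, [/\ uniq Z, (N <= 2 * size Z ^ 2)%N &
    {in Z, forall z, (z < N)%N /\
      exists2 p, exists2 j, (j <= J)%N & p = (Q j)%:R * x \/ p = (Q j)%:R * y &
      exists c : int, z%:R <= N%:R * (p - c%:~R) < z%:R + 1}].
Proof.
move=> N0 xyd step total.
have N0R : 0 < N%:R :> R by rewrite ltr0n.
have N0Z : (N%:Z != 0) by rewrite -lt0n.
pose fl (p : R) : int := Num.floor (N%:R * p).
pose cell (p : R) : nat := `|(fl p %% N%:Z)%Z|%N.
have cellE p : fl p = (fl p %/ N%:Z)%Z * N%:Z + cell p :> int.
  by rewrite gez0_abs ?modz_ge0 // -divz_eq.
pose pts := [seq (Q j)%:R * x | j <- iota 0 J.+1] ++ [seq (Q j)%:R * y | j <- iota 0 J.+1].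
pose Z := undup (map cell pts); exists Z; split.
- exact: undup_uniq.
- pose F (zz : nat * nat) (e : nat) := `|((zz.1%:Z - zz.2%:Z - e%:Z) %% N%:Z)%Z|%N.
  rewrite -[X in (X <= _)%N](size_iota 0).
  pose ZZ := [seq F zz e | zz <- [seq (z, z') | z <- Z, z' <- Z], e <- [:: 0; 1]%N].
  apply: (@leq_trans (size ZZ)); last by rewrite !size_allpairs mulnC.
  apply: uniq_leq_size; first exact: iota_uniq.
  move=> i; rewrite mem_iota /= add0n => iN.
  pose G j := Num.floor (N%:R * (d * (Q j)%:R)).
  (* The representative of [i] modulo [N] in the interval of length [N] from [G 0], which the walk
     covers. *)
  pose m : int := G 0%N + ((i%:Z - G 0%N) %% N%:Z)%Z.
  have stepG j : (j < J)%N -> G j.+1 <= G j + 1.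
    move=> jJ; rewrite -ltzD1 -(ltr_int R) /G !rmorphD /=.
    apply: le_lt_trans (Num.Theory.floor_le _) _.
    have := Num.Theory.floorD1_gt (N%:R * (d * (Q j)%:R)); rewrite rmorphD /=.
    have := step j jJ; rewrite -(ler_pM2l N0R) divff ?gt_eqF // => h1 h2.
    have : N%:R * (d * (Q j.+1)%:R) - N%:R * (d * (Q j)%:R) <= 1.
      by rewrite -!mulrBr.
    by lra.
  have mG : G 0%N <= m <= G J.
    rewrite lerDl modz_ge0 //=.
    apply: (@le_trans _ _ (G 0%N + N%:Z)); first by rewrite lerD2l ltW // ltz_pmod.
    rewrite /G Num.Theory.floor_ge_int rmorphD /=.
    have := Num.Theory.floor_le (N%:R * (d * (Q 0%N)%:R)) => h1.
    have : N%:R <= N%:R * (d * (Q J)%:R) - N%:R * (d * (Q 0%N)%:R).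
      by rewrite -!mulrBr ler_pMr.
    by rewrite -pmulrn; lra.
  have [j jJ Gj] := int_path_ivt stepG mG.
  set u := (Q j)%:R * x; set v := (Q j)%:R * y.
  have uZ : cell u \in Z.
    rewrite mem_undup map_f // mem_cat; apply/orP; left.
    by apply/mapP; exists j => //; rewrite mem_iota.
  have vZ : cell v \in Z.
    rewrite mem_undup map_f // mem_cat; apply/orP; right.
    by apply/mapP; exists j => //; rewrite mem_iota.
  have uv : N%:R * u - N%:R * v = N%:R * (d * (Q j)%:R) + (N%:Z * (Q j)%:Z * c)%:~R.
    rewrite -mulrBr /u /v -mulrBr xyd !rmorphM /= -!pmulrn; ring.
  (* The defect of the floor under subtraction, which is 0 or 1. *)
  pose e : int := fl u - fl v - G j - N%:Z * (Q j)%:Z * c.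
  have e01 : (e == 0) || (e == 1).
    have := Num.Theory.floor_le (N%:R * u); have := Num.Theory.floorD1_gt (N%:R * u).
    have := Num.Theory.floor_le (N%:R * v); have := Num.Theory.floorD1_gt (N%:R * v).
    have := Num.Theory.floor_le (N%:R * (d * (Q j)%:R)).
    have := Num.Theory.floorD1_gt (N%:R * (d * (Q j)%:R)).
    rewrite -/(fl u) -/(fl v) -/(G j) !rmorphD /= => h1 h2 h3 h4 h5 h6.
    have eR : e%:~R = (fl u)%:~R - (fl v)%:~R - (G j)%:~R - (N%:Z * (Q j)%:Z * c)%:~R :> R.
      by rewrite /e !rmorphB.
    have e_gt : (-1)%:~R < e%:~R :> R by rewrite eR rmorphN /=; lra.
    have e_lt : e%:~R < 2%:~R :> R by rewrite eR; lra.
    by move: e_gt e_lt; rewrite !ltr_int; lia.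
  have [n n01 en] : exists2 n, n \in [:: 0; 1]%N & e = n%:Z.
    by case/orP: e01 => /eqP ->; [exists 0%N | exists 1%N].
  apply/allpairsP; exists ((cell u, cell v), n); split => //=.
    by apply/allpairsP; exists (cell u, cell v).
  rewrite /F /=.
  have -> : (cell u)%:Z - (cell v)%:Z - n%:Z = i%:Z +
      (- (fl u %/ N%:Z)%Z + (fl v %/ N%:Z)%Z + (Q j)%:Z * c - ((i%:Z - G 0%N) %/ N%:Z)%Z) * N%:Z.
    have := divz_eq (i%:Z - G 0%N) N%:Z; have := cellE u; have := cellE v.
    by move: en; rewrite /e Gj /m; lra.
  by rewrite addrC modzMDl modz_small.
move=> z; rewrite mem_undup => /mapP[p]; rewrite mem_cat => pP ->; split.
  by rewrite -ltz_nat gez0_abs ?modz_ge0 // ltz_pmod.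
exists p.
  by case/orP: pP => /mapP[j]; rewrite mem_iota add0n ltnS => /= jJ ->; exists j => //; [left|right].
exists (fl p %/ N%:Z)%Z; rewrite mulrBr.
have := Num.Theory.floor_le (N%:R * p); have := Num.Theory.floorD1_gt (N%:R * p).
rewrite rmorphD /=.
have -> : (Num.floor (N%:R * p))%:~R = (fl p %/ N%:Z)%Z%:~R * N%:R + (cell p)%:R :> R.
  by rewrite -/(fl p) {1}cellE rmorphD rmorphM.
by move=> h1 h2; apply/andP; split; lra.
Qed.

Lemma SigmaM (a b q r : nat) : Sigma a b q -> Sigma a b r -> Sigma a b (q * r)%N.
Proof.
move=> [u [v ->]] [u' [v' ->]]; exists (u + u')%N, (v + v')%N.
by rewrite !expnD mulnACA.
Qed.

Lemma SigmaX (a b q n : nat) : Sigma a b q -> Sigma a b (q ^ n)%N.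
Proof.
by move=> [u [v ->]]; exists (u * n)%N, (v * n)%N; rewrite !expnM -expnMn.
Qed.

Lemma Sigma_expn (a b s : nat) : Sigma a b (a ^ s)%N.
Proof. by exists s, 0%N; rewrite expn0 muln1. Qed.

(** The ratio [A / B] is at most [1 + 1 / (2 * J)], so its power [j] stays within [1 + j / J] as
    long as [j <= J]. *)
Lemma close_pair_expn (A B J j : nat) : (B <= A)%N ->
  (2 * J * (A - B) <= B)%N -> (j <= J)%N -> (J * A ^ j <= (J + j) * B ^ j)%N.
Proof.
move=> BA AB; elim: j => [|j IHj] jJ; first by rewrite !expn0 addn0.
have h : (2 * J * A <= (2 * J + 1) * B)%N.
  by rewrite mulnBr in AB; lia.
have := IHj (ltnW jJ); rewrite !expnS => IH.
have J2 : (0 < 2 * J)%N by lia.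
rewrite -(leq_pmul2l J2).
apply: (@leq_trans ((J + j) * B ^ j * (2 * J * A))).
  have -> : (2 * J * (J * (A * A ^ j)) = J * A ^ j * (2 * J * A))%N by lia.
  by rewrite leq_mul2r IH orbT.
apply: (@leq_trans ((J + j) * B ^ j * ((2 * J + 1) * B))).
  by rewrite leq_mul2l h orbT.
have -> : ((J + j) * B ^ j * ((2 * J + 1) * B) =
  (J + j) * (2 * J + 1) * (B * B ^ j))%N by lia.
have hh : ((J + j) * (2 * J + 1) <= 2 * J * (J + j.+1))%N by nia.
by rewrite [X in (_ <= X)%N]mulnA leq_mul2r hh orbT.
Qed.

(* Bounds A ^ J for the pair A, B of [exists_close_pair] with ratio below
   1 + 1 / (2 * J), where J = 2 * a * N. *)
Definition spread (a b N : nat) : nat := (a ^ (16 * a ^ 2 * b * N ^ 2))%N.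

(** The increments of [Q] lie between [a ^ s * D] and twice that. The choice of [s] bounds
    [d * D * a ^ s] by [1 / (2 * N)] and, up to a factor [a], from below, so [J = 2 * a * N] steps
    make a full turn. *)
Lemma orbit_large_cellset (R : realType) (a b N : nat) (x y d : R) (c : int)
    (W := spread a b N) :
    (2 <= a)%N -> (2 <= b)%N -> coprime a b -> (0 < N)%N ->
    x - y = d + c%:~R -> 0 < d -> d * W%:R ^+ 2 <= 1 ->
  exists Z : seq nat, [/\ uniq Z, (N <= 2 * size Z ^ 2)%N &
    {in Z, forall z, (z < N)%N /\
      exists2 p, exists2 q, Sigma a b q /\ d * q%:R <= W%:R & p = q%:R * x \/ p = q%:R * y &
      exists c : int, z%:R <= N%:R * (p - c%:~R) < z%:R + 1}].
Proof.
move=> a2 b2 cab N0 xyd d0 dW; have a0 : (0 < a)%N by exact: ltnW.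
pose J := (2 * a * N)%N; have J0 : (0 < J)%N by rewrite !muln_gt0 a0.
have J20 : (0 < 2 * J)%N by rewrite muln_gt0.
have [A [B [SA SB BA AB AJ]]] := exists_close_pair a2 b2 cab J20.
have NW : (2 * N <= W)%N.
  apply: (@leq_trans (2 ^ (2 * N))); first exact: ltnW (ltn_expl _ _).
  apply: (@leq_trans (a ^ (2 * N))); first by rewrite leq_exp2r // muln_gt0.
  rewrite /W /spread leq_pexp2l // -!mulnn.
  have -> : (16 * (a * a) * b * (N * N) = 2 * N * (8 * (a * a) * b * N))%N by lia.
  by rewrite leq_pmulr // !muln_gt0 a0 N0 !andbT; lia.
have AW : (A ^ J <= W)%N.
  apply: (@leq_trans ((a ^ (2 * b * (2 * J))) ^ J)); first by rewrite leq_exp2r.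
  rewrite -expnM /W /spread /J; apply: eq_leq; congr (_ ^ _)%N.
  by rewrite -!mulnn; lia.
have JR : J%:R = 2 * a%:R * N%:R :> R by rewrite !natrM.
clearbody W J.
have B0 : (0 < B)%N by case: SB => u [v ->]; rewrite muln_gt0 !expn_gt0 a0; lia.
pose D := (B ^ J.-1 * (A - B))%N.
have D0 : (0 < D)%N by rewrite muln_gt0 expn_gt0 B0 subn_gt0.
have DA : (D <= A ^ J)%N.
  rewrite -[J in X in (_ <= X)%N](prednK J0) expnSr /D leq_mul ?leq_subr //.
  by case: (J.-1) => // n; rewrite leq_exp2r // ltnW.
have N0R : 0 < N%:R :> R by rewrite ltr0n.
have D0R : 0 < D%:R :> R by rewrite ltr0n.
have W0 : 0 < W%:R :> R by rewrite ltr0n (leq_trans _ NW) // muln_gt0.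
have sig0 : 0 < d * D%:R by rewrite mulr_gt0.
(* Here [d * W ^ 2 <= 1] enters, through [D <= W] and [2 * N <= W]. *)
have sigN : d * D%:R <= (2 * N%:R)^-1.
  rewrite -[leRHS]mul1r ler_pdivlMr ?mulr_gt0 //; apply: le_trans dW.
  rewrite -mulrA ler_pM2l // expr2.
  by apply: ler_pM; rewrite ?mulr_ge0 // -?natrM ler_nat // (leq_trans DA AW).
have [s /andP[s_le s_lt]] := exists_expn_between a2 sig0 sigN.
pose Q j := (a ^ s * (A ^ j * B ^ (J - j)))%N.
have aR : a%:R ^+ s = (a ^ s)%:R :> R by rewrite natrX.
have step j : (j < J)%N -> d * ((Q j.+1)%:R - (Q j)%:R) <= N%:R^-1.
  move=> jJ.
  have QE : (Q j.+1)%:R - (Q j)%:R = (a ^ s * (A ^ j * B ^ (J.-1 - j) * (A - B)))%:R :> R.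
    have -> : Q j.+1 = (a ^ s * (A ^ j * B ^ (J.-1 - j) * A))%N.
      rewrite /Q subnS predn_sub.
      by rewrite expnS [(A * _)%N]mulnC -!mulnA [(A * _)%N]mulnC.
    have -> : Q j = (a ^ s * (A ^ j * B ^ (J.-1 - j) * B))%N.
      rewrite /Q -predn_sub -[(J - j)%N in LHS]prednK ?subn_gt0 //.
      by rewrite expnSr !mulnA.
    by rewrite -natrB -?mulnBr // !leq_mul2l (ltnW BA) !orbT.
  have ABD : (A ^ j * B ^ (J.-1 - j) * (A - B) <= 2 * D)%N.
    rewrite mulnA leq_mul2r; apply/orP; right.
    rewrite -(leq_pmul2l J0) mulnA.
    apply: (@leq_trans ((J + j) * B ^ j * B ^ (J.-1 - j))).
      by rewrite leq_mul2r close_pair_expn ?orbT // ltnW.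
    rewrite -mulnA -expnD subnKC; last by rewrite -ltnS prednK.
    by rewrite mulnA leq_mul2r muln2 -addnn leq_add2l (ltnW jJ) orbT.
  rewrite QE natrM -aR; apply: (@le_trans _ _ (d * (a%:R ^+ s * (2 * D%:R)))).
    by rewrite ler_pM2l // ler_wpM2l ?exprn_ge0 // -natrM ler_nat.
  have : 2 * (d * D%:R * a%:R ^+ s) <= 2 * (2 * N%:R)^-1 by rewrite ler_pM2l.
  by rewrite invfM mulVKf //; lra.
have total : 1 <= d * ((Q J)%:R - (Q 0%N)%:R).
  have QE : (a ^ s * (J * D))%:R <= (Q J)%:R - (Q 0%N)%:R :> R.
    rewrite /Q subnn subn0 !expn0 muln1 mul1n.
    rewrite -natrB; last by rewrite leq_mul2l leq_exp2r // (ltnW BA) orbT.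
    rewrite ler_nat -mulnBr leq_mul2l; apply/orP; right.
    rewrite subn_exp /D mulnA mulnC leq_mul2l; apply/orP; right.
    rewrite -[X in (X * _ <= _)%N](card_ord J) -sum_nat_const; apply: leq_sum => i _.
    have iJ : (i <= J.-1)%N by rewrite -ltnS prednK.
    rewrite -{1}(subnK iJ) expnD leq_mul2r; apply/orP; right.
    by case: (J.-1 - i)%N => // n; rewrite leq_exp2r // ltnW.
  apply: le_trans (_ : _ <= d * (a ^ s * (J * D))%:R) _; last by rewrite ler_pM2l.
  have : 1 <= 2 * N%:R * (d * D%:R * a%:R ^+ s.+1).
    by rewrite -ler_pdivrMl ?mulr_gt0 // mulr1 ltW.
  by rewrite !natrM -aR JR exprS; lra.
have [Z [uZ NZ ZP]] := large_cellset N0 xyd step total.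
exists Z; split => // z /ZP[zN [p [j jJ pE] cP]]; split => //.
exists p => //; exists (Q j) => //; split.
  by apply: SigmaM (Sigma_expn _ _ _) (SigmaM (SigmaX _ SA) (SigmaX _ SB)).
have das : d * a%:R ^+ s <= 1.
  apply: le_trans (_ : d * D%:R * a%:R ^+ s <= 1); last first.
    apply: le_trans s_le _; rewrite invf_le1 ?mulr_gt0 //.
    by rewrite -natrM ler1n muln_gt0.
  by rewrite ler_pM2r ?exprn_gt0 ?ltr0n // ler_peMr ?ler1n // ltW.
have QW : (A ^ j * B ^ (J - j))%:R <= W%:R :> R.
  rewrite ler_nat; apply: leq_trans AW.
  rewrite -[in X in (_ <= X)%N](subnKC jJ) expnD leq_mul2l.
  by apply/orP; right; case: (J - j)%N => // n; rewrite leq_exp2r // ltnW.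
rewrite /Q natrM -aR mulrA -[W%:R]mul1r; apply: ler_pM => //.
by rewrite mulr_ge0 ?exprn_ge0 // ltW.
Qed.

(** * Choice of the scale *)

Lemma spread_ge (a b N : nat) : (2 <= a)%N -> (2 <= b)%N -> (N <= spread a b N)%N.
Proof.
move=> a2 b2; have a0 : (0 < a)%N by exact: ltnW.
case: N => // N; apply: leq_trans (ltnW (ltn_expl _ a2)) _; rewrite leq_pexp2l //.
by rewrite -[(N.+1 ^ 2)%N]mulnn mulnA leq_pmull // !muln_gt0 ?expn_gt0 a0 /=; lia.
Qed.

Lemma cells_ge (a E k : nat) : (2 <= a)%N -> (0 < E)%N -> (k <= cells a E k)%N.
Proof.
move=> a2 E0; have a0 : (0 < a)%N by exact: ltnW.
apply: leq_trans (ltnW (ltn_expl k a2)) _; rewrite leq_pexp2l //.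
apply: (@leq_trans (7 * k).+1); first by lia.
by rewrite leq_pmull // muln_gt0 E0 expn_gt0 a0.
Qed.

Lemma dist_int_le (R : realType) (x : R) (c : int) : dist_int x <= `|x - c%:~R|.
Proof. by have [_] := dist_int_min x; apply. Qed.

(** Here [n] comes from the approximation of [alpha], before [k] is chosen; this order of
    quantifiers lets [k] be maximised for the given [n]. *)
Lemma exists_close_at_scale (R : realType) (a b : nat) (alpha beta : R) :
    (2 <= a)%N -> (2 <= b)%N -> coprime a b -> irrational alpha ->
  exists E k0 : nat, (0 < E)%N /\ forall n0 : nat, exists2 n, (n0 <= n)%N &
    forall k, (k0 <= k)%N -> (spread a b (cells a E k) ^ 2 <= n)%N ->
    exists q, [/\ Sigma a b q, (a ^ n <= q <= a ^ (10 * n))%N &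
      dist_int (q%:R * alpha - beta) <= 2 / a%:R ^+ k].
Proof.
move=> a2 b2 cab ia; have a0 : (0 < a)%N by exact: ltnW.
have b0 : (0 < b)%N by exact: ltnW.
have [E [k0 [E0 dilate]]] := dilate_large_cellset R a2 b2 cab.
exists E, k0; split=> // n0.
have [n n0n [u [u' [/andP[nu un] /andP[nu' un'] [c /andP[d_ge d_lt]]]]]] :=
  exists_small_difference a2 ia n0.
exists n => // k k0k Wn.
set d := _ - c%:~R in d_ge d_lt.
pose N := cells a E k; pose W := spread a b N.
have N0 : (0 < N)%N by rewrite expn_gt0 a0.
have NW : (N <= W)%N by exact: spread_ge.
have W0 : (0 < W)%N by exact: leq_trans NW.
have n_gt0 : (0 < n)%N by apply: leq_trans Wn; rewrite expn_gt0 W0.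
have pw0 : 0 < a%:R ^+ (2 * n + 4) :> R by rewrite exprn_gt0 ?ltr0n.
have d0 : 0 < d by apply: lt_le_trans d_ge; rewrite invr_gt0.
have dW : d * W%:R ^+ 2 <= 1.
  apply: (@le_trans _ _ (n%:R^-1 * n%:R)); last by rewrite mulVf // pnatr_eq0 -lt0n.
  by rewrite ler_pM ?exprn_ge0 ?(ltW d0) ?(ltW d_lt) // -natrX ler_nat.
have xyd : (a ^ u)%:R * alpha - (a ^ u')%:R * alpha = d + c%:~R by rewrite /d subrK.
have [Z [uZ NZ ZP]] := orbit_large_cellset a2 b2 cab N0 xyd d0 dW.
have [p [q [Sq dq] pE] [s [t [c' stN near]]]] := dilate k k0k _ Z uZ ZP NZ beta.
have [v nv pv] : exists2 v, (n <= v <= 2 * n)%N & p = q%:R * ((a ^ v)%:R * alpha).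
  by case: pE => ->; [exists u|exists u'] => //; apply/andP.
have q0 : (0 < q)%N by case: Sq => i [j ->]; rewrite muln_gt0 !expn_gt0 a0 b0.
have qW : (q <= W * a ^ (2 * n + 4))%N.
  rewrite -(ler_nat R) natrM natrX -ler_pdivrMr //.
  by apply: le_trans dq; rewrite mulrC ler_pM2r ?ltr0n.
have st0 : (0 < a ^ s * b ^ t)%N by rewrite muln_gt0 !expn_gt0 a0 b0.
(* Here [a ^ v] lies between [a ^ n] and [a ^ (2 * n)], [q] is at most [W * a ^ (2 * n + 4)], and
   [N ^ 2 * W <= n ^ 2 <= a ^ (2 * n)]; the exponents add up to [6 * n + 4]. *)
exists (a ^ s * b ^ t * (q * a ^ v))%N; split.
- by apply: SigmaM (SigmaM Sq (Sigma_expn _ _ _)); exists s, t.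
- case/andP: nv => nv vn; apply/andP; split.
    apply: (@leq_trans (a ^ v)); first by rewrite leq_pexp2l.
    by rewrite mulnA leq_pmull // muln_gt0 st0.
  have N2W : (N ^ 2 * W <= n * n)%N.
    apply: leq_mul; first by apply: leq_trans Wn; rewrite leq_exp2r.
    by apply: leq_trans Wn; rewrite -mulnn leq_pmulr.
  have na : (n * n <= a ^ (2 * n))%N.
    by rewrite mul2n -addnn expnD leq_mul // ltnW // ltn_expl.
  apply: (@leq_trans (N ^ 2 * (W * a ^ (2 * n + 4) * a ^ (2 * n)))).
    apply: leq_mul; first exact: stN.
    by apply: leq_mul; [exact: qW | rewrite leq_pexp2l].
  rewrite !mulnA; apply: (@leq_trans (a ^ (2 * n) * a ^ (2 * n + 4) * a ^ (2 * n))).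
    by rewrite !leq_mul2r (leq_trans N2W na) !orbT.
  by rewrite -!expnD leq_pexp2l //; lia.
apply: le_trans (dist_int_le _ c') _; apply: le_trans near.
by rewrite pv !natrM !mulrA.
Qed.

(** * Bounds for iterated logarithms *)

Lemma ln_le_expn (R : realType) (a m : nat) (x : R) : (0 < a)%N ->
  x <= a%:R ^+ m -> ln x <= (m * a)%:R.
Proof.
(* [ln] vanishes on nonpositive reals, so the bound can be iterated without positivity conditions;
   [ln a <= a] keeps it a natural number. *)
move=> a0 xa; have [x0|x0] := ltP 0 x; last by rewrite (ln0 x0).
have aR : 0 < a%:R :> R by rewrite ltr0n.
apply: (@le_trans _ _ (ln (a%:R ^+ m))).
  by rewrite ler_ln ?posrE ?exprn_gt0.
by rewrite lnXn // natrM mulr_natl ler_wMn2r // ltW // ln_sublinear.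
Qed.

Lemma lnlnln_le (R : realType) (a b n q M : nat) : (2 <= a)%N -> (2 <= b)%N ->
    (q <= a ^ (10 * n))%N -> (n <= spread a b (a ^ M) ^ 2)%N ->
  ln (ln (ln q%:R)) <= ((9 + b + 2 * M) * a)%:R :> R.
Proof.
move=> a2 b2 qn nW; have a0 : (0 < a)%N by exact: ltnW.
have e10 : (10 <= a ^ 4)%N by apply: (@leq_trans (2 ^ 4)); rewrite // leq_exp2r.
have e37 : (37 <= a ^ 6)%N by apply: (@leq_trans (2 ^ 6)); rewrite // leq_exp2r.
have ba : (b <= a ^ b)%N by exact: ltnW (ltn_expl _ a2).
have l1 : ln q%:R <= (10 * n * a)%:R :> R.
  by apply: ln_le_expn => //; rewrite -natrX ler_nat.
(* [a ^ e] covers [10 * n * a]: 4 powers for the 10, 1 for [a], the rest is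
   [spread a b (a ^ M) ^ 2]. *)
pose e := (5 + 32 * a ^ 2 * b * (a ^ M) ^ 2)%N.
have l2 : ln (ln q%:R) <= (e * a)%:R :> R.
  apply: ln_le_expn => //; apply: le_trans l1 _; rewrite -natrX ler_nat.
  have -> : (a ^ e = a ^ 4 * spread a b (a ^ M) ^ 2 * a)%N.
    rewrite /spread -expnM -expnD -expnSr; congr (_ ^ _)%N; rewrite /e; lia.
  by rewrite leq_mul2r leq_mul ?orbT.
apply: ln_le_expn => //; apply: le_trans l2 _; rewrite -natrX ler_nat.
have -> : (a ^ (9 + b + 2 * M) = a ^ 6 * (a ^ 2 * a ^ b * (a ^ M) ^ 2) * a)%N.
  by rewrite -expnM -!expnD -expnSr; congr (_ ^ _)%N; lia.
rewrite leq_mul2r; apply/orP; right.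
apply: (@leq_trans (37 * (a ^ 2 * b * (a ^ M) ^ 2))).
  have : (0 < a ^ 2 * b * (a ^ M) ^ 2)%N.
    by rewrite !muln_gt0 !expn_gt0 a0 (ltnW b2).
  by rewrite /e -!mulnA; lia.
by apply: leq_mul => //; rewrite leq_mul2r leq_mul2l ba !orbT.
Qed.

(** Source of the exponent 1/8: the bound on the triple logarithm is of order [k * a ^ (7 * k)],
    eventually below [a ^ (8 * k)]. The shift to [k + 1] reflects that the next scale no longer
    fits; [2 ^ 8] comes from [(a ^ k / 2) ^ 8]. *)
Lemma cells_growth (a b E : nat) : (2 <= a)%N -> exists k1, forall k, (k1 <= k)%N ->
  ((9 + b + 2 * (E * a ^ (7 * k.+1) * (7 * k.+1).+1)) * a * 2 ^ 8 <= a ^ (8 * k))%N.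
Proof.
move=> a2; have a0 : (0 < a)%N by exact: ltnW.
have [k1 k1P] := poly_lt_exp2 ((9 + b + 16 * E * a ^ 7) * a * 2 ^ 8) 1.
exists k1 => k /k1P kP.
have X0 : (0 < a ^ (7 * k))%N by rewrite expn_gt0 a0.
apply: (@leq_trans ((9 + b + 16 * E * a ^ 7) * a * 2 ^ 8 * k.+1 ^ 1 * a ^ (7 * k))).
  rewrite expn1.
  have -> : ((9 + b + 16 * E * a ^ 7) * a * 2 ^ 8 * k.+1 * a ^ (7 * k) =
    (9 + b + 16 * E * a ^ 7) * (k.+1 * a ^ (7 * k)) * a * 2 ^ 8)%N.
    move: (9 + b + _)%N (2 ^ 8)%N (a ^ (7 * k))%N => u w X; lia.
  rewrite !leq_mul2r; apply/orP; right; apply/orP; right.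
  rewrite mulnDl; apply: leq_add.
    by rewrite leq_pmulr // muln_gt0 X0.
  rewrite (_ : 7 * k.+1 = 7 + 7 * k)%N ?mulnS // expnD.
  move: (a ^ 7)%N (a ^ (7 * k))%N => p X; nia.
have -> : (8 * k = k + 7 * k)%N by lia.
rewrite expnD leq_mul2r; apply/orP; right; apply: leq_trans (ltnW kP) _.
by case: (k) => // k'; rewrite leq_exp2r.
Qed.

Lemma lnlnln_ge1 (R : realType) : exists n1 : nat, forall q : nat,
  (n1 <= q)%N -> 1 <= ln (ln (ln q%:R)) :> R.
Proof.
exists (Num.truncn (expR (expR (expR 1)) : R)).+1 => q n1q.
have q3 : expR (expR (expR 1)) <= q%:R :> R.
  apply: ltW; apply: lt_le_trans (Num.Theory.truncnS_gt _) _.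
  by rewrite ler_nat.
have le_ln (x y : R) : expR x <= y -> x <= ln y.
  move=> xy; rewrite -[x in x <= _]expRK ler_ln ?posrE ?expR_gt0 //.
  exact: lt_le_trans (expR_gt0 _) xy.
by apply: (le_ln); apply: (le_ln); apply: (le_ln).
Qed.

Theorem theorem2 (R : realType) (a b : nat) (alpha beta : R)
    (ha : (2 <= a)%N) (hb : (2 <= b)%N) (hab : coprime a b)
    (halpha : irrational alpha) :
  forall eps : R, 0 < eps ->
    infinite_set [set q : nat | Sigma a b q /\
      dist_int (q%:R * alpha - beta) <=
        1 / (ln (ln (ln q%:R)) `^ (1 / 8 - eps))].
Proof.
move=> eps eps0; have a0 : (0 < a)%N by exact: ltnW.
have aR : 0 < a%:R :> R by rewrite ltr0n.
have [E [k0 [E0 approx]]] := exists_close_at_scale beta ha hb hab halpha.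
have [k1 growth] := cells_growth b E ha.
have [n1 ge1] := lnlnln_ge1 R.
pose F k := (spread a b (cells a E k) ^ 2)%N.
have Fk k : (k <= F k)%N.
  apply: leq_trans (cells_ge k ha E0) _.
  apply: leq_trans (spread_ge _ ha hb) _.
  by rewrite -[X in (X <= _)%N]expn1 leq_pexp2l // expn_gt0 a0.
(* A finite set of naturals is bounded, so solutions beyond every [X] suffice. *)
suff large X : exists q, [/\ (X < q)%N, Sigma a b q & dist_int (q%:R * alpha - beta) <=
    1 / (ln (ln (ln q%:R)) `^ (1 / 8 - eps))].
  move=> /finite_seqP[s sE].
  have [q [Xq Sq dq]] := large (\max_(x <- s) x).
  have : q \in s by have : [set` s] q by rewrite -sE.
  by move=> qs; move: Xq; rewrite ltnNge leq_bigmax_seq.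
pose kk := maxn k0 k1.
have [n n_ge nP] := approx (maxn (F kk) (maxn X.+1 n1)).
move: n_ge; rewrite !geq_max => /and3P[Fn Xn n1n].
have ex : exists k, (k0 <= k)%N && (k1 <= k)%N && (F k <= n)%N.
  by exists kk; rewrite leq_maxl leq_maxr.
have bd k : (k0 <= k)%N && (k1 <= k)%N && (F k <= n)%N -> (k <= n)%N.
  by case/andP => _; exact: leq_trans.
(* The largest admissible scale: failure of [k + 1] bounds [n], hence [q], from above in terms of
   [k]. *)
case: (ex_maxnP ex bd) => k /andP[/andP[k0k k1k] Fkn] kmax.
have nF : (n < F k.+1)%N.
  rewrite ltnNge; apply/negP => h; have := kmax k.+1.
  by rewrite h (leqW k0k) (leqW k1k) ltnn => /(_ isT).
have [q [Sq /andP[nq qn] dq]] := nP k k0k Fkn.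
have nan : (n < a ^ n)%N by exact: ltn_expl.
exists q; split=> //; first exact: leq_ltn_trans (ltnW Xn) (leq_trans nan nq).
apply: le_trans dq _.
have y1 := ge1 q (leq_trans n1n (leq_trans (ltnW nan) nq)).
have yY := lnlnln_le R ha hb qn (ltnW nF).
set y := ln (ln (ln q%:R)) in y1 yY *.
(* The bound [2 / a ^ k] is [1 / Y], so [y] is to be compared with [Y ^ 8]. *)
pose Y : R := a%:R ^+ k / 2.
have Y0 : 0 < Y by rewrite divr_gt0 ?exprn_gt0.
have {}yY : y <= Y ^+ 8.
  apply: le_trans yY _; rewrite /Y expr_div_n ler_pdivlMr ?exprn_gt0 // -exprM -!natrX -natrM ler_nat.
  by rewrite [(k * 8)%N]mulnC growth.
(* As [y >= 1], dropping [eps] only increases the power, also when [1 / 8 - eps] is negative. *)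
have yp : y `^ (1 / 8 - eps) <= Y.
  apply: (@le_trans _ _ (y `^ (1 / 8))).
    by apply: ler_powR => //; lra.
  apply: (@le_trans _ _ ((Y ^+ 8) `^ (1 / 8))).
    apply: ge0_ler_powR; rewrite ?nnegrE ?exprn_ge0 ?(ltW Y0) //; lra.
  rewrite -powR_mulrn ?(ltW Y0) // -powRrM mulrCA divff ?pnatr_eq0 // mulr1 powRr1 ?(ltW Y0) //.
have yp0 : 0 < y `^ (1 / 8 - eps) by rewrite powR_gt0 //; lra.
have -> : 2 / a%:R ^+ k = Y^-1 by rewrite /Y invf_div.
by rewrite div1r lef_pV2 ?posrE.
Qed.
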